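(* Let $n\ge 2$ agents communicate over an undirected connected weighted graph with Laplacian $L$. Let $f_1,\dots,f_n:\mathbb{R}^d\to\mathbb{R}$ be differentiable with $\|\nabla f_i(x)-\nabla f_i(y)\|\le L_f\|x-y\|$ for all $x,y\in\mathbb{R}^d$, $i\in[n]$, where $L_f>0$. Let $f=\frac1n\sum_{i=1}^n f_i$, assume that $f^*=\min_{x\in\mathbb{R}^d}f(x)$ is finite, and assume that $f$ satisfies the Polyak–Łojasiewicz condition with constant $\nu>0$: $\frac12\|\nabla f(x)\|^2\ge\nu(f(x)-f^* )$ for all $x\in\mathbb{R}^d$. Let $\mathcal{C}:\mathbb{R}^d\to\mathbb{R}^d$ be a (possibly random) compressor such that, for some constants $\varphi\in(0,1]$ and $r>0$, $\mathbf{E}_{\mathcal C}\big[\|\mathcal{C}(x)/r-x\|^2\big]\le(1-\varphi)\|x\|^2$ for all $x\in\mathbb{R}^d$. Let $\{x_{i,k}\}$ be generated by Algorithm 1 (see context) with $\alpha=\kappa_1\beta$, $\beta>\kappa_2$, $\eta\in(0,\kappa_3)$ and $\psi\in(0,1/r]$, where $\kappa_1,\kappa_2,\kappa_3$ are the positive constants defined in the context. Let $\bar x_k=\frac1n\sum_{i=1}^n x_{i,k}$. Then the constant $\epsilon$ defined in the context lies in $(0,1)$ and, for any $k\in\mathbb{N}_0$, $$\sum_{i=1}^{n}\mathbf{E}_{\mathcal{C}}\big[\|x_{i,k}-\bar{x}_k\|^2+f(\bar{x}_k)-f^*\big]=\mathcal{O}((1-\epsilon)^{k}),$$ i.e. the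 left side is at most a constant independent of $k$ times $(1-\epsilon)^k$.
   Context: Notation: $\mathbb{N}_0$ is the set of nonnegative integers, $[n]=\{1,\dots,n\}$, $\|\cdot\|$ is the Euclidean norm. The graph has symmetric weighted adjacency matrix $A=(a_{ij})$, $a_{ij}\ge0$, $a_{ii}=0$; $(i,j)$ is an edge iff $a_{ij}>0$; $L=(L_{ij})=\mathrm{diag}(\sum_j a_{1j},\dots,\sum_j a_{nj})-A$. $\rho(L)$ is the spectral radius of $L$ and $\rho_2(L)$ its smallest positive eigenvalue. $\mathbf{E}_{\mathcal C}$ is expectation over the internal randomness of the compressor; each application of $\mathcal C$ uses fresh randomness, so the compressor inequality holds conditionally on the past. Algorithm 1: positive parameters $\alpha,\beta,\eta,\psi$. Initialize with arbitrary (deterministic) $x_{i,0}\in\mathbb{R}^d$, $a_{i,0}=b_{i,0}=v_{i,0}=\mathbf 0_d$, $q_{i,0}=\mathcal C(x_{i,0})$. For $k=0,1,\dots$ and all $i\in[n]$: $a_{i,k+1}=a_{i,k}+\psi q_{i,k}$; $b_{i,k+1}=b_{i,k}+\psi\big(q_{i,k}-\sum_{j=1}^nL_{ij}q_{j,k}\big)$; $x_{i,k+1}=x_{i,k}-\eta\alpha\big(a_{i,k}-b_{i,k}+\sum_{j=1}^nL_{ij}q_{j,k}\big)-\eta(\beta v_{i,k}+\nabla f_i(x_{i,k}))$; $v_{i,k+1}=v_{i,k}+\eta\beta\big(a_{i,k}-b_{i,k}+\sum_{j=1}^nL_{ij}q_{j,k}\big)$; $q_{i,k+1}=\mathcal C(x_{i,k+1}-a_{i,k+1})$.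 Constants: $r_0=2r^2(1-\varphi)+2(1-r)^2$. $\kappa_4>0$ is any constant; $\kappa_1$ is any constant with $\kappa_1\ge\max\{\frac{9+\kappa_4}{2\rho_2(L)},1\}$; $\kappa_5=\max\{\frac{4+5L_f^2}{\kappa_4},\frac{6}{\rho_2(L)}\}$; $\kappa_6=\frac{8(\kappa_1+1)^2L_f^2}{\kappa_5\rho_2(L)}+\frac{4L_f^2}{\rho_2^2(L)}$; $\kappa_2=\max\{\kappa_5,\sqrt{\kappa_6}\}$; $\kappa_3=\min\Big\{\frac{\epsilon_1}{\epsilon_2},\frac{\epsilon_3}{\epsilon_4},\frac{\epsilon_5}{\epsilon_6},\frac{\sqrt{\epsilon_8^2+4\epsilon_7\epsilon_9}-\epsilon_8}{2\epsilon_9}\Big\}$ (the last term is omitted if $r_0=0$), with $\epsilon_1=\frac{\alpha}{2}\rho_2(L)-\frac14(9\beta+4+5L_f^2)$, $\epsilon_2=3L_f^2+\frac{4(2+\varphi\psi r)}{\varphi\psi r}(\alpha^2\rho^2(L)+L_f^2)+2\beta^2+1+3\alpha^2\rho^2(L)$, $\epsilon_3=\frac{\beta}{2}-3\rho_2^{-1}(L)$, $\epsilon_4=2\beta^2\rho(L)+\frac{4(2+\varphi\psi r)\beta^2\rho^2(L)}{\varphi\psi r}+\rho_2^{-1}(L)$, $\epsilon_5=\frac18-\frac{(\alpha+\beta)^2L_f^2}{\beta^5\rho_2(L)}-\frac{L_f^2}{2\beta^2\rho_2^2(L)}$, $\epsilon_6=\frac{(\alpha+\beta)L_f^2}{2\beta^3\rho_2(L)}+\frac{3L_f^2}{4}+\frac{L_f^2}{2\beta^2\rho_2^2(L)}+\frac{L_f}{2}$,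 $\epsilon_7=\frac{\varphi\psi r}{2}(1+\varphi\psi r)$, $\epsilon_8=\frac12(\alpha+2\beta)\rho(L)r_0+2\beta r_0$, $\epsilon_9=\frac{(8+7\varphi\psi r)\alpha^2\rho^2(L)r_0}{\varphi\psi r}+(2\beta^2+1)r_0$. Finally $\epsilon=\epsilon_{12}/\epsilon_{11}$ with $\epsilon_{11}=\max\{\frac12+\frac{\alpha}{\beta},\frac{\alpha\rho_2(L)+\beta}{2\alpha\rho_2(L)}\}$ and $\epsilon_{12}=\eta\min\{\epsilon_1-\eta\epsilon_2,\ \epsilon_3-\eta\epsilon_4,\ \frac{\nu}{2},\ \frac{\epsilon_7}{\eta}-\epsilon_8-\eta\epsilon_9\}$. *)

(* Defs.v *)
From HB Require Import structures.
From mathcomp Require Import all_boot all_order all_algebra.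
From mathcomp Require Import all_classical all_reals all_analysis.
From mathcomp Require Import complex.

Set Implicit Arguments.
Unset Strict Implicit.
Unset Printing Implicit Defensive.

Import Order.TTheory GRing.Theory Num.Theory.
Import numFieldNormedType.Exports.

Local Open Scope classical_set_scope.
Local Open Scope ring_scope.

(* The library norm on ['rV[R]_d] is the sup norm, hence this definition. The
   two norms are equivalent, so the library topology, differentiability and
   derivatives on ['rV[R]_d] are the usual ones on R^d. *)
Definition enorm (R : realType) (d : nat) (x : 'rV[R]_d) : R :=
  Num.sqrt (\sum_(j < d) x 0 j ^+ 2).

(* Meaningful when [f] is differentiable at [x]. *)
Definition grad (R : realType) (d : nat) (f : 'rV[R]_d -> R) (x : 'rV[R]_d)
    : 'rV[R]_d :=
  \row_(j < d) 'D_(delta_mx 0 j) f x.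

Definition average (R : realType) (n d : nat) (u : 'I_n -> 'rV[R]_d)
    : 'rV[R]_d :=
  n%:R^-1 *: \sum_(i < n) u i.

Definition average_cost (R : realType) (n d : nat) (f : 'I_n -> 'rV[R]_d -> R)
    (x : 'rV[R]_d) : R :=
  n%:R^-1 * \sum_(i < n) f i x.

Definition is_minimum (R : realType) (T : Type) (f : T -> R) (m : R) : Prop :=
  (exists x, f x = m) /\ (forall x, m <= f x).

Definition polyak_lojasiewicz (R : realType) (d : nat) (f : 'rV[R]_d -> R)
    (fstar nu : R) : Prop :=
  forall x, nu * (f x - fstar) <= 2^-1 * enorm (grad f x) ^+ 2.

Definition is_adjacency (R : realType) (n : nat) (A : 'M[R]_n) : Prop :=
  [/\ A^T = A, forall i j, 0 <= A i j & forall i, A i i = 0].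

Definition graph_connected (R : realType) (n : nat) (A : 'M[R]_n) : Prop :=
  forall i j, connect [rel u v | 0 < A u v] i j.

Definition laplacian (R : realType) (n : nat) (A : 'M[R]_n) : 'M[R]_n :=
  diag_mx (\row_(i < n) \sum_(j < n) A i j) - A.

(* The complex eigenvalues of [M] form a finite set, so the supremum is a
   maximum. *)
Definition spectral_radius (R : realType) (n : nat) (M : 'M[R]_n) : R :=
  sup [set ComplexField.Normc.normc z
      | z in [set z : R[i] | eigenvalue (map_mx (real_complex R) M) z]].

(* A minimum as soon as [M] has a positive eigenvalue, which is the case for
   the Laplacian of a connected graph on at least two vertices. *)
Definition min_pos_eigenvalue (R : realType) (n : nat) (M : 'M[R]_n) : R :=
  inf [set a : R | 0 < a /\ eigenvalue M a].

Definition borel_rV (R : realType) (d : nat) :=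
  g_sigma_algebraType [set U : set 'rV[R]_d | open U].

(* A random map of R^d is a function [C z x] of a seed [z] with law [mu]; a
   deterministic map is the case of a one-point seed space. *)
Definition is_compressor (R : realType) (d : nat) (dZ : measure_display)
    (Z : measurableType dZ) (mu : probability Z R)
    (C : Z -> 'rV[R]_d -> 'rV[R]_d) (phi r : R) : Prop :=
  measurable_fun [set: Z * borel_rV R d]
    (fun p : Z * borel_rV R d => (C p.1 p.2 : borel_rV R d)) /\
  forall x : 'rV[R]_d,
    (\int[mu]_z (enorm (r^-1 *: C z x - x) ^+ 2)%:E
       <= ((1 - phi) * enorm x ^+ 2)%:E)%E.

Definition iid_with_law (R : realType) (I : choiceType)
    (dO : measure_display) (Omega : measurableType dO) (P : probability Omega R)
    (dZ : measure_display) (Z : measurableType dZ) (mu : probability Z R)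
    (X : I -> Omega -> Z) : Prop :=
  [/\ forall i, measurable_fun [set: Omega] (X i),
      forall i (B : set Z), measurable B -> P (X i @^-1` B) = mu B
    & forall (s : seq I) (B : I -> set Z), uniq s ->
        (forall i, measurable (B i)) ->
        P (\bigcap_(i in [set` s]) (X i @^-1` B i))
          = (\prod_(i <- s) P (X i @^-1` B i))%E].

Record state (R : realType) (n d : nat) := State {
  st_a : 'I_n -> 'rV[R]_d;
  st_b : 'I_n -> 'rV[R]_d;
  st_x : 'I_n -> 'rV[R]_d;
  st_v : 'I_n -> 'rV[R]_d;
  st_q : 'I_n -> 'rV[R]_d }.

(* [Ck k i] is the realization of the compressor used by agent [i] to produce
   its message [q_{i,k}]. *)
Fixpoint algorithm (R : realType) (n d : nat) (L : 'M[R]_n)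
    (f : 'I_n -> 'rV[R]_d -> R) (alpha beta eta psi : R)
    (x0 : 'I_n -> 'rV[R]_d) (Ck : nat -> 'I_n -> 'rV[R]_d -> 'rV[R]_d)
    (k : nat) {struct k} : state R n d :=
  match k with
  | 0 => State (fun=> 0) (fun=> 0) x0 (fun=> 0) (fun i => Ck 0%N i (x0 i))
  | k'.+1 =>
    let s := algorithm L f alpha beta eta psi x0 Ck k' in
    let a := st_a s in let b := st_b s in let x := st_x s in
    let v := st_v s in let q := st_q s in
    let Lq := fun i => \sum_(j < n) L i j *: q j in
    let a' := fun i => a i + psi *: q i in
    let b' := fun i => b i + psi *: (q i - Lq i) in
    let x' := fun i => x i - (eta * alpha) *: (a i - b i + Lq i)
                       - eta *: (beta *: v i + grad (f i) (x i)) in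
    let v' := fun i => v i + (eta * beta) *: (a i - b i + Lq i) in
    State a' b' x' v' (fun i => Ck k'.+1 i (x' i - a' i))
  end.

(* Below, [rho] and [rho2] stand for the spectral radius and the smallest
   positive eigenvalue of the Laplacian. *)
Section Constants.
Variable R : realType.
Variables rho rho2 Lf nu phi r alpha beta eta psi kappa1 kappa4 : R.

Definition kappa5 : R := Num.max ((4 + 5 * Lf ^+ 2) / kappa4) (6 / rho2).
Definition kappa6 : R :=
  8 * (kappa1 + 1) ^+ 2 * Lf ^+ 2 / (kappa5 * rho2)
  + 4 * Lf ^+ 2 / rho2 ^+ 2.
Definition kappa2 : R := Num.max kappa5 (Num.sqrt kappa6).

Definition r0 : R := 2 * r ^+ 2 * (1 - phi) + 2 * (1 - r) ^+ 2.

Definition eps1 : R :=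
  alpha / 2 * rho2 - 4^-1 * (9 * beta + 4 + 5 * Lf ^+ 2).
Definition eps2 : R :=
  3 * Lf ^+ 2
  + 4 * (2 + phi * psi * r) / (phi * psi * r)
    * (alpha ^+ 2 * rho ^+ 2 + Lf ^+ 2)
  + 2 * beta ^+ 2 + 1 + 3 * alpha ^+ 2 * rho ^+ 2.
Definition eps3 : R := beta / 2 - 3 * rho2^-1.
Definition eps4 : R :=
  2 * beta ^+ 2 * rho
  + 4 * (2 + phi * psi * r) * beta ^+ 2 * rho ^+ 2 / (phi * psi * r)
  + rho2^-1.
Definition eps5 : R :=
  8^-1 - (alpha + beta) ^+ 2 * Lf ^+ 2 / (beta ^+ 5 * rho2)
  - Lf ^+ 2 / (2 * beta ^+ 2 * rho2 ^+ 2).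
Definition eps6 : R :=
  (alpha + beta) * Lf ^+ 2 / (2 * beta ^+ 3 * rho2)
  + 3 * Lf ^+ 2 / 4
  + Lf ^+ 2 / (2 * beta ^+ 2 * rho2 ^+ 2)
  + Lf / 2.
Definition eps7 : R := phi * psi * r / 2 * (1 + phi * psi * r).
Definition eps8 : R :=
  2^-1 * (alpha + 2 * beta) * rho * r0 + 2 * beta * r0.
Definition eps9 : R :=
  (8 + 7 * phi * psi * r) * alpha ^+ 2 * rho ^+ 2 * r0 / (phi * psi * r)
  + (2 * beta ^+ 2 + 1) * r0.

(* When [r0 = 0], [eps9] vanishes and the last term of the minimum is
   omitted. *)
Definition kappa3 : R :=
  let m := Num.min (eps1 / eps2) (Num.min (eps3 / eps4) (eps5 / eps6)) in
  if r0 == 0 then m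
  else Num.min m ((Num.sqrt (eps8 ^+ 2 + 4 * eps7 * eps9) - eps8) / (2 * eps9)).

Definition eps11 : R :=
  Num.max (2^-1 + alpha / beta) ((alpha * rho2 + beta) / (2 * alpha * rho2)).
Definition eps12 : R :=
  eta * Num.min (eps1 - eta * eps2)
       (Num.min (eps3 - eta * eps4)
       (Num.min (nu / 2) (eps7 / eta - eps8 - eta * eps9))).
Definition epsilon : R := eps12 / eps11.

End Constants.

(* Main.v *)
(* Stack the agents' vectors into matrices and put J = 11^T / n, K = 1 - J.
   Since a_k - b_k = L a_k, the iteration only involves u = a_k + q_k, which
   equals x_k up to the compression error e.  With Q the pseudo-inverse of L,
   z = Q (v + grad f (xbar) / beta) and y = x - a, the function
     V = |K x|^2 / 2 + (alpha / beta + 1) / 2 <z, L z> + <K x, z>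
         + n (f (xbar) - fstar) + |y|^2
   satisfies, for every outcome of the compressor,
     V' + c (1 - phi) |y|^2 <= (1 - epsilon) V + c |q / r - y|^2.
   The message q_k uses seeds independent of y_k, so the expectation of the last
   term is at most c (1 - phi) E |y|^2 and V contracts in mean.  The weight Q in
   the cross term (it makes it <K x, z>) is what produces eps11. *)

Require Import Defs.
From HB Require Import structures.
From mathcomp Require Import all_boot all_order all_algebra.
From mathcomp Require Import all_classical all_reals all_analysis.
From mathcomp Require Import measurable_realfun complex ring lra.
Set Implicit Arguments.
Unset Strict Implicit.
Unset Printing Implicit Defensive.
Import Order.TTheory GRing.Theory Num.Theory.
Import numFieldNormedType.Exports.
Local Open Scope classical_set_scope.
Local Open Scope ring_scope.

(** * Inner products and quadratic forms *)

(** The surplus [c (1 - phi) |y|^2] sits on the left of the pointwise inequality so that all terms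
    are nonnegative: both sides integrate in the extended reals with no integrability assumption,
    and the induction bounding [E V] supplies the finiteness needed to cancel the surplus.
    Independence enters only in the mean of [|q / r - y|^2], by Tonelli rather than by conditional
    expectation. The dual variable does not follow a linear recursion: since [z] contains the
    gradients at [xbar], each step adds a drift [delta], with [L delta] at most [eta Lf / beta]
    times the averaged gradient. The descent of [f] along that average pays for it, which is the
    role of [eps5] and [eps6]. With [s = phi psi r], the compression terms average to
    [|e|^2 <= r0 |y|^2], weighted by [eps8] and [eps9], and to the factor
    [(1 + s / 2) (1 - s) = 1 - eps7] on [|y|^2]. *)

Definition mxdot (R : realFieldType) (n d : nat) (X Y : 'M[R]_(n, d)) : R :=
  \tr (X *m Y^T).

Lemma mxdotE (R : realFieldType) n d (X Y : 'M[R]_(n, d)) :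
  mxdot X Y = \sum_i \sum_j X i j * Y i j.
Proof.
rewrite /mxdot /mxtrace; apply: eq_bigr => i _; rewrite mxE.
by apply: eq_bigr => j _; rewrite mxE.
Qed.

Lemma mxdotC (R : realFieldType) n d (X Y : 'M[R]_(n, d)) :
  mxdot X Y = mxdot Y X.
Proof. by rewrite /mxdot -mxtrace_tr trmx_mul trmxK. Qed.

Lemma mxdotDl (R : realFieldType) n d (X Y Z : 'M[R]_(n, d)) :
  mxdot (X + Y) Z = mxdot X Z + mxdot Y Z.
Proof. by rewrite /mxdot mulmxDl linearD. Qed.

Lemma mxdotZl (R : realFieldType) n d a (X Y : 'M[R]_(n, d)) :
  mxdot (a *: X) Y = a * mxdot X Y.
Proof. by rewrite /mxdot -scalemxAl linearZ. Qed.

Lemma mxdotNl (R : realFieldType) n d (X Y : 'M[R]_(n, d)) :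
  mxdot (- X) Y = - mxdot X Y.
Proof. by rewrite -scaleN1r mxdotZl mulN1r. Qed.

Lemma mxdotDr (R : realFieldType) n d (X Y Z : 'M[R]_(n, d)) :
  mxdot X (Y + Z) = mxdot X Y + mxdot X Z.
Proof. by rewrite mxdotC mxdotDl !(mxdotC X). Qed.

Lemma mxdotZr (R : realFieldType) n d a (X Y : 'M[R]_(n, d)) :
  mxdot X (a *: Y) = a * mxdot X Y.
Proof. by rewrite mxdotC mxdotZl mxdotC. Qed.

Lemma mxdotNr (R : realFieldType) n d (X Y : 'M[R]_(n, d)) :
  mxdot X (- Y) = - mxdot X Y.
Proof. by rewrite mxdotC mxdotNl mxdotC. Qed.

Lemma mxdot0l (R : realFieldType) n d (X : 'M[R]_(n, d)) : mxdot 0 X = 0.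
Proof. by rewrite /mxdot mul0mx linear0. Qed.

Definition mxdot_lin (R : realFieldType) n d :=
  (@mxdotDl R n d, @mxdotDr R n d, @mxdotNl R n d, @mxdotNr R n d,
   @mxdotZl R n d, @mxdotZr R n d).

Lemma mxdot_ge0 (R : realFieldType) n d (X : 'M[R]_(n, d)) : 0 <= mxdot X X.
Proof.
by rewrite mxdotE; apply: sumr_ge0 => i _; apply: sumr_ge0 => j _;
  rewrite -expr2 sqr_ge0.
Qed.

Lemma mxdot_mull (R : realFieldType) n d (M : 'M[R]_n) (X Y : 'M[R]_(n, d)) :
  mxdot (M *m X) Y = mxdot X (M^T *m Y).
Proof. by rewrite /mxdot trmx_mul trmxK mulmxA -mulmxA mxtrace_mulC. Qed.

Section PsdForm.
Variables (R : realFieldType) (n d : nat) (M : 'M[R]_n).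
Hypothesis (Msym : M^T = M).

Lemma mxform_sym (X Y : 'M[R]_(n, d)) : mxdot X (M *m Y) = mxdot Y (M *m X).
Proof. by rewrite mxdotC mxdot_mull Msym. Qed.

Hypothesis Mpsd : forall X : 'M[R]_(n, d), 0 <= mxdot X (M *m X).

(** Positivity of the form at [c *: X + Y] and at [c *: X - Y], divided by [2 c]. *)
Lemma mxform_young (c : R) (X Y : 'M[R]_(n, d)) : 0 < c ->
  - (c / 2 * mxdot X (M *m X) + (2 * c)^-1 * mxdot Y (M *m Y))
     <= mxdot X (M *m Y)
     <= c / 2 * mxdot X (M *m X) + (2 * c)^-1 * mxdot Y (M *m Y).
Proof.
move=> c0.
have key s : s ^+ 2 = 1 -> 0 <= c / 2 * mxdot X (M *m X)
    + (2 * c)^-1 * mxdot Y (M *m Y) + s * mxdot X (M *m Y).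
  move=> s1.
  have := Mpsd (c *: X + s *: Y).
  rewrite !(mulmxDr, mxdot_lin) -!scalemxAr !mxdot_lin (mxform_sym Y X).
  set a := mxdot X _; set b := mxdot Y _; set e := mxdot X _ => h.
  have -> : c / 2 * a + (2 * c)^-1 * b + s * e =
    (2 * c)^-1 * (c * (c * a) + s * (c * e) + (c * (s * e) + s ^+ 2 * b)).
    by rewrite s1; field; lra.
  apply: mulr_ge0; first by rewrite invr_ge0; lra.
  by move: h; rewrite expr2; lra.
have sN1 : (-1) ^+ 2 = 1 :> R by rewrite sqrrN expr1n.
have := key 1 (expr1n _ _); have := key (-1) sN1; lra.
Qed.

Variable rho : R.
Hypothesis rho_gt0 : 0 < rho.
Hypothesis Mle : forall X : 'M[R]_(n, d), mxdot X (M *m X) <= rho * mxdot X X.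

(** Young for the form [M] between [M *m X] and [X], with weight [1 / rho], bounds the left side by
    half of itself plus half of the right side; no spectral decomposition enters. *)
Lemma mxform_norm_le (X : 'M[R]_(n, d)) :
  mxdot (M *m X) (M *m X) <= rho * mxdot X (M *m X).
Proof.
have rV : 0 < rho^-1 by rewrite invr_gt0.
have /andP[_] := mxform_young (M *m X) X rV.
have := Mle (M *m X).
set a := mxdot (M *m X) (M *m (M *m X)); set b := mxdot (M *m X) (M *m X).
move=> h1 h2.
have h3 : rho^-1 * a <= b by rewrite mulrC ler_pdivrMr // mulrC.
move: h2; rewrite invfM invrK; lra.
Qed.

Lemma mxform_norm_le2 (X : 'M[R]_(n, d)) :
  mxdot (M *m X) (M *m X) <= rho ^+ 2 * mxdot X X.
Proof.
apply: (le_trans (mxform_norm_le X)); rewrite expr2 -mulrA.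
by apply: ler_wpM2l (Mle X); exact: ltW.
Qed.

End PsdForm.

Lemma mxdot_young (R : realFieldType) n d (c : R) (X Y : 'M[R]_(n, d)) :
  0 < c ->
  - (c / 2 * mxdot X X + (2 * c)^-1 * mxdot Y Y) <= mxdot X Y
     <= c / 2 * mxdot X X + (2 * c)^-1 * mxdot Y Y.
Proof.
move=> c0; have h (Z : 'M[R]_(n, d)) : 0 <= mxdot Z (1%:M *m Z).
  by rewrite mul1mx mxdot_ge0.
by have := mxform_young (trmx1 _ _) h X Y c0; rewrite !mul1mx.
Qed.

Lemma mxdot_add_le (R : realFieldType) n d (s : R) (X Y : 'M[R]_(n, d)) :
  0 < s ->
  mxdot (X + Y) (X + Y) <= (1 + s) * mxdot X X + (1 + s^-1) * mxdot Y Y.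
Proof.
move=> s0; have /andP[_] := mxdot_young X Y s0.
rewrite !mxdot_lin (mxdotC Y X) invfM => h; lra.
Qed.

(** * The primal-dual step *)

(** The weight [kappa + 1] makes the coupling [<x, L z>] cancel at first order in [eta]: in units of
    [beta] it collects [-1] from the square, [kappa + 1] from the middle term and [- kappa] from the
    cross term. *)
Definition pd_lyap (R : realFieldType) n d (kappa : R) (L : 'M[R]_n)
    (x z : 'M[R]_(n, d)) : R :=
  2^-1 * mxdot x x + (kappa + 1) / 2 * mxdot z (L *m z) + mxdot x z.

Section PrimalDualStep.
Variables (R : realFieldType) (n d : nat) (L : 'M[R]_n).
Hypothesis Lsym : L^T = L.
Variables (kappa beta eta : R) (x z e g delta : 'M[R]_(n, d)).

Let b (X Y : 'M[R]_(n, d)) := mxdot X (L *m Y).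
Let u := x + e.
Let p := (kappa * beta) *: (L *m u) + beta *: (L *m z) + g.

(** An exact identity, so that all losses come from later Young inequalities. Here [e] is the
    centred compression error and [delta] the part of the motion of [z] that is not driven by
    [u]. *)
Lemma pd_lyap_step_eq :
  pd_lyap kappa L (x - eta *: p) (z + (eta * beta) *: u + delta) =
  pd_lyap kappa L x z
  + eta * (- (kappa * beta) * (b x x + b x e)
           + beta * (mxdot x x + mxdot x e + b z e - b z z)
           - mxdot x g - mxdot g z)
  + (kappa + 1) * b z delta + mxdot x delta
  + eta ^+ 2 / 2 * mxdot p p
  + eta ^+ 2 * (beta ^+ 2 * (1 - kappa) / 2 * b u u
                - beta ^+ 2 * b z u - beta * mxdot g u)
  + eta * beta * b u delta - eta * beta * b z delta - eta * mxdot g delta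
  + (kappa + 1) / 2 * b delta delta.
Proof.
have S (X Y : 'M[R]_(n, d)) := mxform_sym Lsym X Y; rewrite /pd_lyap /b.
have S' (X Y : 'M[R]_(n, d)) : mxdot (L *m X) Y = mxdot X (L *m Y) by rewrite mxdotC S.
have ep q : mxdot (x - eta *: q) (x - eta *: q) =
    mxdot x x - 2 * eta * mxdot x q + eta ^+ 2 * mxdot q q.
  by rewrite !mxdot_lin (mxdotC q x); ring.
have ex q Y : mxdot (x - eta *: q) Y = mxdot x Y - eta * mxdot q Y.
  by rewrite !mxdot_lin.
rewrite ep !ex; clear ep ex.
(* [mxdot p p] stays folded: it is bounded separately and is needed again for the motion of the
   primal iterate. *)
set pp := mxdot p p; rewrite /p /u.
rewrite !(mulmxDr, =^~scalemxAr, mxdot_lin) !S'.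
rewrite (S delta x) (S delta e) (S delta z) (S x z) (S e z) (S e x).
rewrite (mxdotC x g).
by field; rewrite ?pnatr_eq0.
Qed.


Variables (rho rho2 ell theta : R).
Hypotheses (Lpsd : forall X : 'M[R]_(n, d), 0 <= b X X)
  (Lle : forall X : 'M[R]_(n, d), b X X <= rho * mxdot X X)
  (rho_gt0 : 0 < rho) (rho2_gt0 : 0 < rho2)
  (kappa_ge1 : 1 <= kappa) (beta_gt0 : 0 < beta) (eta_gt0 : 0 < eta)
  (xgap : rho2 * mxdot x x <= b x x) (zgap : rho2 * mxdot z z <= b z z)
  (dgap : rho2 * mxdot delta delta <= b delta delta)
  (gle : mxdot g g <= ell ^+ 2 * mxdot x x)
  (dle : mxdot (L *m delta) (L *m delta) <= eta ^+ 2 * theta).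

(** Two splittings with constant 2 give the 4. The [z] part uses [|L z|^2 <= rho <z, L z>] because
    the decrease of the Lyapunov function is measured by [<z, L z>]. *)
Lemma pd_drive_le :
  mxdot p p <= 4 * ((kappa * beta) ^+ 2 * rho ^+ 2 * (mxdot x x + mxdot e e)
     + beta ^+ 2 * rho * b z z + ell ^+ 2 * mxdot x x).
Proof.
have tri (X Y : 'M[R]_(n, d)) :
    mxdot (X + Y) (X + Y) <= 2 * (mxdot X X + mxdot Y Y).
  by have := mxdot_add_le X Y (@ltr01 R); rewrite invr1; lra.
rewrite /p /u mulmxDr scalerDr -addrA.
apply: (le_trans (tri _ _)).
have h1 := tri ((kappa * beta) *: (L *m x)) ((kappa * beta) *: (L *m e)).
have h2 := tri (beta *: (L *m z)) g.
apply: (@le_trans _ _ (2 * (2 * ((kappa * beta) ^+ 2 *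
    (mxdot (L *m x) (L *m x) + mxdot (L *m e) (L *m e)))
    + 2 * (beta ^+ 2 * mxdot (L *m z) (L *m z) + mxdot g g)))).
  by move: h1 h2; rewrite !(mxdotZl, mxdotZr); lra.
have n2 := mxform_norm_le2 Lsym Lpsd rho_gt0 Lle.
have k0 := sqr_ge0 (kappa * beta); have b0 := sqr_ge0 beta.
have := ler_wpM2l k0 (n2 x); have := ler_wpM2l k0 (n2 e).
have := ler_wpM2l b0 (mxform_norm_le Lsym Lpsd rho_gt0 Lle z).
have := gle; rewrite -/(b z z); lra.
Qed.

(* Young's inequality on every cross term, with weights chosen so that the
   resulting coefficients fit the constants [eps1]-[eps9]; [T7] and the slack
   [5/8 - 1/2] in front of [z] are what [dual_coef_ge] relies on. *)
Lemma pd_lyap_step_le :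
  pd_lyap kappa L (x - eta *: p) (z + (eta * beta) *: u + delta) <=
  pd_lyap kappa L x z
  - (eta * (kappa * beta * rho2 / 2 - 9 / 8 * beta - 1 - 3 / 4 * ell ^+ 2)
     - eta ^+ 2 * (2 * beta ^+ 2 + 1 + ell ^+ 2)) * mxdot x x
  + (eta * (kappa * beta * rho / 2 + 2 * beta + beta * rho)
     + eta ^+ 2 * (2 * beta ^+ 2 + 1)) * mxdot e e
  - (eta * (5 / 8 * beta - rho2^-1)
     - eta ^+ 2 * (beta ^+ 2 * rho / 2 + rho2^-1)) * b z z
  + eta ^+ 2 / 2 * mxdot p p
  + (eta * (2 * (kappa + 1) ^+ 2 / (beta * rho2) + rho2^-1 ^+ 2 / 2)
     + eta ^+ 2 * (3 / 4 * beta ^+ 2 + rho2^-1 ^+ 2 / 2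
                   + (kappa + 1) / (2 * rho2))) * theta.
Proof.
have Sb (X Y : 'M[R]_(n, d)) : mxdot (L *m X) Y = b X Y.
  by rewrite mxdotC /b mxform_sym.
have rV0 : 0 < rho2^-1 by rewrite invr_gt0.
(* Young with weight [rho2] absorbs half of [rho2 |delta|^2 <= <delta, L delta>], which turns the
   bound on [L delta] into one on [delta]. *)
have dd : mxdot delta delta <= rho2^-1 ^+ 2 * (eta ^+ 2 * theta).
  have /andP[_] := mxdot_young delta (L *m delta) rho2_gt0.
  rewrite -/(b delta delta) => h.
  have : rho2 * mxdot delta delta <= rho2^-1 * (eta ^+ 2 * theta).
    have := ler_wpM2l (ltW rV0) dle; move: h dgap; rewrite invfM; lra.
  rewrite -(ler_pM2l rV0) mulrA mulVf ?gt_eqF // mul1r; lra.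
have bdd : b delta delta <= rho2^-1 * (eta ^+ 2 * theta).
  have /andP[_] := mxdot_young delta (L *m delta) rho2_gt0.
  rewrite -/(b delta delta) invfM.
  have := ler_wpM2l (ltW rV0) dle; move: dgap; lra.
have zz : mxdot z z <= rho2^-1 * b z z.
  by rewrite -(ler_pM2l rho2_gt0) mulrA divff ?gt_eqF // mul1r.
have k1 : 0 < kappa + 1 by move: kappa_ge1; lra.
have ? := gle; have ? := xgap.
have e0 : 0 < eta := eta_gt0; have b0 : 0 < beta := beta_gt0.
have uu : mxdot u u <= 2 * (mxdot x x + mxdot e e).
  by have := mxdot_add_le x e (@ltr01 R); rewrite invr1 -/u; lra.
rewrite pd_lyap_step_eq.
have T1 : - b x e <= 2^-1 * b x x + 2^-1 * (rho * mxdot e e).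
  have /andP[] := mxform_young Lsym Lpsd x e (@ltr01 R).
  by have := Lle e; rewrite -!/(b _ _) mulr1; lra.
have T2 : mxdot x e <= mxdot x x / 8 + 2 * mxdot e e.
  have q : (0 : R) < 4^-1 by rewrite invr_gt0.
  have /andP[_] := mxdot_young x e q.
  by rewrite invfM invrK; lra.
have T3 : b z e <= b z z / 4 + rho * mxdot e e.
  have q : (0 : R) < 2^-1 by rewrite invr_gt0.
  have /andP[_] := mxform_young Lsym Lpsd z e q.
  by have := Lle e; rewrite -!/(b _ _) divff ?pnatr_eq0 // invr1; lra.
have T5 : - mxdot x g <= 2^-1 * mxdot x x + 2^-1 * (ell ^+ 2 * mxdot x x).
  by have /andP[] := mxdot_young x g (@ltr01 R); rewrite mulr1; lra.
have T6 : - mxdot g z <= 4^-1 * (ell ^+ 2 * mxdot x x) + rho2^-1 * b z z.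
  have q : (0 : R) < 2^-1 by rewrite invr_gt0.
  have /andP[] := mxdot_young g z q.
  by rewrite divff ?pnatr_eq0 // invr1; lra.
have T7 : (kappa + 1) * b z delta <= eta * (beta / 8 * b z z)
    + eta * (2 * (kappa + 1) ^+ 2 / (beta * rho2) * theta).
  have q : 0 < eta * beta / (4 * (kappa + 1)).
    by rewrite divr_gt0 ?mulr_gt0.
  have /andP[_] := mxform_young Lsym Lpsd z delta q.
  rewrite -!/(b _ _) -(ler_pM2l k1) => /le_trans; apply.
  have s0 : 0 <= 2 * (kappa + 1) ^+ 2 / (eta * beta).
    by rewrite divr_ge0 ?mulr_ge0 ?sqr_ge0 ?ltW.
  have := ler_wpM2l s0 bdd.
  have -> : 2 * (kappa + 1) ^+ 2 / (eta * beta)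
       * (rho2^-1 * (eta ^+ 2 * theta))
     = eta * (2 * (kappa + 1) ^+ 2 / (beta * rho2) * theta).
    by field; rewrite !gt_eqF.
  have -> : (kappa + 1) * (eta * beta / (4 * (kappa + 1)) / 2 * b z z
      + (2 * (eta * beta / (4 * (kappa + 1))))^-1 * b delta delta) =
    eta * (beta / 8 * b z z)
      + 2 * (kappa + 1) ^+ 2 / (eta * beta) * b delta delta.
    by field; rewrite !gt_eqF // mulr_gt0.
  by lra.
have T8 : mxdot x delta <= eta / 2 * mxdot x x
    + eta * (rho2^-1 ^+ 2 / 2 * theta).
  have /andP[_] := mxdot_young x delta e0.
  have s0 : 0 <= (2 * eta)^-1 by rewrite invr_ge0 mulr_ge0 ?ltW.
  have := ler_wpM2l s0 dd.
  have -> : (2 * eta)^-1 * (rho2^-1 ^+ 2 * (eta ^+ 2 * theta)) =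
     eta * (rho2^-1 ^+ 2 / 2 * theta) by field; rewrite !gt_eqF.
  by lra.
(* [kappa >= 1] makes this square term nonpositive, so it is dropped rather than estimated. *)
have T10 : beta ^+ 2 * (1 - kappa) / 2 * b u u <= 0.
  rewrite -oppr_ge0 -mulNr; apply: mulr_ge0 (Lpsd u).
  have k0 : 0 <= kappa - 1 by rewrite subr_ge0.
  by have := mulr_ge0 (sqr_ge0 beta) k0; lra.
have T11 : - (beta ^+ 2 * b z u) <= beta ^+ 2 * rho / 2 * b z z
    + beta ^+ 2 * (mxdot x x + mxdot e e).
  have /andP[+ _] := mxdot_young (L *m z) u (@ltr01 R).
  rewrite (Sb z u) mulr1; have := mxform_norm_le Lsym Lpsd rho_gt0 Lle z.
  rewrite -/(b z z) => h1 h2.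
  have h3 : - b z u <= rho / 2 * b z z + (mxdot x x + mxdot e e) by lra.
  by have := ler_wpM2l (sqr_ge0 beta) h3; lra.
have T12 : - (beta * mxdot g u) <= 2^-1 * (ell ^+ 2 * mxdot x x)
    + beta ^+ 2 * (mxdot x x + mxdot e e).
  have q : 0 < beta^-1 by rewrite invr_gt0.
  have /andP[+ _] := mxdot_young g u q.
  rewrite lerNl -(ler_pM2l b0) => h.
  rewrite -mulrN; apply: (le_trans h).
  have -> : beta * (beta^-1 / 2 * mxdot g g + (2 * beta^-1)^-1 * mxdot u u) =
    2^-1 * mxdot g g + beta ^+ 2 / 2 * mxdot u u by field; rewrite !gt_eqF.
  have := ler_wpM2l (sqr_ge0 beta) uu; lra.
have T13 : eta * beta * b u delta <= eta ^+ 2 * (mxdot x x + mxdot e e)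
    + beta ^+ 2 / 2 * (eta ^+ 2 * theta).
  have q : 0 < eta / beta by rewrite divr_gt0.
  have /andP[_] := mxdot_young u (L *m delta) q.
  rewrite -/(b u delta) -(ler_pM2l (mulr_gt0 e0 b0)) => /le_trans; apply.
  have -> : eta * beta * (eta / beta / 2 * mxdot u u
      + (2 * (eta / beta))^-1 * mxdot (L *m delta) (L *m delta)) =
    eta ^+ 2 / 2 * mxdot u u
      + beta ^+ 2 / 2 * mxdot (L *m delta) (L *m delta).
    by field; rewrite !gt_eqF.
  have := ler_wpM2l (sqr_ge0 eta) uu; have := ler_wpM2l (sqr_ge0 beta) dle.
  by lra.
have T14 : - (eta * beta * b z delta) <= eta ^+ 2 * (rho2^-1 * b z z)
    + beta ^+ 2 / 4 * (eta ^+ 2 * theta).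
  have q : 0 < 2 * (eta / beta) by rewrite mulr_gt0 ?divr_gt0.
  have /andP[+ _] := mxdot_young z (L *m delta) q.
  rewrite -/(b z delta) lerNl -(ler_pM2l (mulr_gt0 e0 b0)).
  rewrite -mulrN => /le_trans; apply.
  have -> : eta * beta * (2 * (eta / beta) / 2 * mxdot z z
      + (2 * (2 * (eta / beta)))^-1 * mxdot (L *m delta) (L *m delta)) =
    eta ^+ 2 * mxdot z z
      + beta ^+ 2 / 4 * mxdot (L *m delta) (L *m delta).
    by field; rewrite !gt_eqF.
  have := ler_wpM2l (sqr_ge0 eta) zz; have := ler_wpM2l (sqr_ge0 beta) dle.
  by lra.
have T15 : - (eta * mxdot g delta) <= eta ^+ 2 / 2 * (ell ^+ 2 * mxdot x x)
    + rho2^-1 ^+ 2 / 2 * (eta ^+ 2 * theta).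
  have /andP[+ _] := mxdot_young g delta e0.
  rewrite lerNl -(ler_pM2l e0) -mulrN => /le_trans; apply.
  have -> : eta * (eta / 2 * mxdot g g + (2 * eta)^-1 * mxdot delta delta) =
    eta ^+ 2 / 2 * mxdot g g + 2^-1 * mxdot delta delta.
    by field; rewrite !gt_eqF.
  have := ler_wpM2l (sqr_ge0 eta) gle; lra.
have T16 : (kappa + 1) / 2 * b delta delta <=
    (kappa + 1) / (2 * rho2) * (eta ^+ 2 * theta).
  have := ler_wpM2l (ltW k1) bdd.
  have -> : (kappa + 1) / (2 * rho2) = (kappa + 1) * rho2^-1 / 2.
    by field; rewrite !gt_eqF.
  by lra.
have kb : 0 <= kappa * beta := mulr_ge0 (le_trans ler01 kappa_ge1) (ltW b0).
(* First-order terms are summed before multiplying by [eta], second-order ones ([U2]) before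
   multiplying by [eta ^+ 2]; the rest is linear in the resulting products. *)
have U1 : - (kappa * beta) * (b x x + b x e)
    + beta * (mxdot x x + mxdot x e + b z e - b z z)
    - mxdot x g - mxdot g z <=
  - (kappa * beta * rho2 / 2 - 9 / 8 * beta - 2^-1 - 3 / 4 * ell ^+ 2) * mxdot x x
  + (kappa * beta * rho / 2 + 2 * beta + beta * rho) * mxdot e e
  - (3 / 4 * beta - rho2^-1) * b z z.
  have := ler_wpM2l kb T1; have := ler_wpM2l kb xgap.
  have := ler_wpM2l (ltW b0) T2; have := ler_wpM2l (ltW b0) T3.
  by rewrite -!/(b _ _); lra.
have := ler_wpM2l (ltW e0) U1.
have U2 : beta ^+ 2 * (1 - kappa) / 2 * b u u
                - beta ^+ 2 * b z u - beta * mxdot g u <=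
  (2 * beta ^+ 2 + 2^-1 * ell ^+ 2) * mxdot x x + 2 * beta ^+ 2 * mxdot e e
  + beta ^+ 2 * rho / 2 * b z z by lra.
have := ler_wpM2l (sqr_ge0 eta) U2.
clear U1 U2 T1 T2 T3 T5 T6 T10 T11 T12 uu zz dd bdd.
move: T7 T8 T13 T14 T15 T16.
set bb := _ / (beta * rho2); set rr := rho2^-1; set r2 := _ / (2 * rho2).
lra.
Qed.
End PrimalDualStep.

Ltac positivity :=
  repeat first
    [ by [] | assumption | by apply: ltW; assumption
    | exact: sqr_ge0 | apply: addr_gt0 | apply: mulr_gt0 | apply: exprn_gt0
    | rewrite invr_gt0 | apply: addr_ge0 | apply: mulr_ge0 | apply: exprn_ge0
    | rewrite invr_ge0 ].

(** * The step-size conditions *)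

Section StepSizes.
Variables (R : realType) (rho rho2 Lf nu phi r beta eta psi kappa1 kappa4 : R).
Local Notation alpha := (kappa1 * beta).
Local Notation s := (phi * psi * r).
Hypotheses (rho2_gt0 : 0 < rho2) (rho2_le : rho2 <= rho) (Lf_gt0 : 0 < Lf)
  (nu_gt0 : 0 < nu)
  (phi01 : 0 < phi <= 1) (r_gt0 : 0 < r) (psi01 : 0 < psi <= r^-1)
  (kappa4_gt0 : 0 < kappa4)
  (hkappa1 : Num.max ((9 + kappa4) / (2 * rho2)) 1 <= kappa1)
  (hbeta : kappa2 rho2 Lf kappa1 kappa4 < beta)
  (heta : 0 < eta < kappa3 rho rho2 Lf phi r alpha beta psi).

Lemma psir01 : 0 < psi * r <= 1.
Proof.
case/andP: psi01 => p0 p1; rewrite mulr_gt0 //=.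
by have := ler_wpM2r (ltW r_gt0) p1; rewrite mulVf ?gt_eqF.
Qed.

Lemma s01 : 0 < s <= 1.
Proof.
case/andP: psir01 => p0 p1; case/andP: phi01 => h0 h1.
by rewrite -mulrA mulr_gt0 //= mulr_ile1 // ltW.
Qed.

Lemma kappa1_ge1 : 1 <= kappa1.
Proof. by move: hkappa1; rewrite ge_max => /andP[]. Qed.

Lemma kappa1_rho2 : (9 + kappa4) / 2 <= kappa1 * rho2.
Proof.
move: hkappa1; rewrite ge_max => /andP[h _].
rewrite -ler_pdivrMr //; apply: le_trans h.
by rewrite invfM mulrA lexx.
Qed.

Local Notation k5 := (kappa5 rho2 Lf kappa4).

Lemma kappa5_gt0 : 0 < k5.
Proof. by rewrite /kappa5 lt_max; apply/orP; right; rewrite divr_gt0. Qed.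

Lemma kappa5_lt : k5 < beta.
Proof. by move: hbeta; rewrite /kappa2 gt_max => /andP[]. Qed.

Lemma beta_gt0 : 0 < beta.
Proof. exact: lt_trans kappa5_gt0 kappa5_lt. Qed.

Lemma beta_kappa4 : 4 + 5 * Lf ^+ 2 < beta * kappa4.
Proof.
by have := kappa5_lt; rewrite /kappa5 gt_max ltr_pdivrMr // => /andP[].
Qed.

(** Multiplying [kappa1 rho2 >= (9 + kappa4) / 2] by [beta] leaves [beta kappa4 / 2], which exceeds
    2. *)
Lemma alpha_rho2 : 9 / 2 * beta + 2 < alpha * rho2.
Proof.
have b0 := beta_gt0; have := ler_wpM2l (ltW b0) kappa1_rho2.
have := beta_kappa4; have := sqr_ge0 Lf; lra.
Qed.

Local Notation e2 := (eps2 rho Lf phi r alpha beta psi).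
Local Notation e4 := (eps4 rho rho2 phi r beta psi).
Local Notation e6 := (eps6 rho2 Lf alpha beta).
Local Notation e7 := (eps7 phi r psi).
Local Notation e8 := (eps8 rho phi r alpha beta).
Local Notation e9 := (eps9 rho phi r alpha beta psi).

Lemma rho_gt0 : 0 < rho. Proof. exact: lt_le_trans rho2_gt0 rho2_le. Qed.

Lemma alpha_ge : beta <= alpha.
Proof.
by rewrite  ler_peMl ?(ltW beta_gt0) // kappa1_ge1.
Qed.

Lemma alpha_gt0 : 0 < alpha.
Proof. exact: lt_le_trans beta_gt0 alpha_ge. Qed.

(** What is kept is quadratic in [alpha rho] while [eps1] is at most linear in it, so
    [eta < eps1 / eps2] bounds [eta alpha rho]. *)
Lemma eps2_ge : (8 / s + 7) * (alpha ^+ 2 * rho ^+ 2) <= e2.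
Proof.
have /andP[s0 _] := s01.
have h : 0 <= (8 / s + 4) * Lf ^+ 2.
  by rewrite mulr_ge0 ?sqr_ge0 // addr_ge0 // divr_ge0 // ltW.
have -> : e2 = 3 * Lf ^+ 2 + (8 / s + 4) * (alpha ^+ 2 * rho ^+ 2 + Lf ^+ 2)
    + 2 * beta ^+ 2 + 1 + 3 * alpha ^+ 2 * rho ^+ 2.
  by move: s0; rewrite /eps2; set t := s => s0; field; rewrite gt_eqF.
by have := sqr_ge0 beta; have := sqr_ge0 Lf; lra.
Qed.

Lemma eps2_gt0 : 0 < e2.
Proof.
apply: lt_le_trans eps2_ge; have /andP[s0 _] := s01.
apply: mulr_gt0; first by rewrite addr_gt0 ?divr_gt0.
by apply: mulr_gt0; rewrite exprn_gt0 ?alpha_gt0 ?rho_gt0.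
Qed.

Lemma eps4_gt0 : 0 < e4.
Proof.
have /andP[s0 _] := s01; have b0 := beta_gt0; have p0 := rho_gt0.
rewrite /eps4 ltr_wpDl ?invr_gt0 //.
positivity.
Qed.

Lemma eps6_gt0 : 0 < e6.
Proof.
have b0 := beta_gt0; have a0 := alpha_gt0; have l0 := Lf_gt0.
rewrite /eps6 ltr_wpDl ?divr_gt0 //.
positivity.
Qed.

Lemma eta_gt0 : 0 < eta. Proof. by case/andP: heta. Qed.

Lemma eta_lt_min : eta < Num.min (eps1 rho2 Lf alpha beta / e2)
   (Num.min (eps3 rho2 beta / e4) (eps5 rho2 Lf alpha beta / e6)).
Proof.
case/andP: heta => _; rewrite /kappa3; case: ifP => // _.
by rewrite lt_min => /andP[].
Qed.

Lemma eta_eps2 : eta * e2 < eps1 rho2 Lf alpha beta.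
Proof. by move: eta_lt_min; rewrite lt_min ltr_pdivlMr ?eps2_gt0 // => /andP[]. Qed.

Lemma eta_eps4 : eta * e4 < eps3 rho2 beta.
Proof.
move: eta_lt_min; rewrite !lt_min => /and3P[_ + _].
by rewrite ltr_pdivlMr ?eps4_gt0.
Qed.

Lemma eta_eps6 : eta * e6 < eps5 rho2 Lf alpha beta.
Proof.
move: eta_lt_min; rewrite !lt_min => /and3P[_ _].
by rewrite ltr_pdivlMr ?eps6_gt0.
Qed.

Lemma r0_ge0 : 0 <= r0 phi r.
Proof.
case/andP: phi01 => _; rewrite -subr_ge0 /r0 => h; positivity.
Qed.

Lemma eps7_gt0 : 0 < e7.
Proof.
have /andP[s0 _] := s01; rewrite /eps7.
positivity.
Qed.

Lemma eps7_le1 : e7 <= 1.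
Proof.
have /andP[s0 s1] := s01; rewrite /eps7.
have : s * s <= 1 by rewrite mulr_ile1 // ltW.
lra.
Qed.

(* Weight of the compression error [e] in the Lyapunov estimate; the identity
   [r0 * err_coef = eta * eps8 + eta ^+ 2 * eps9] explains [eps8] and [eps9]. *)
Definition err_coef : R :=
  eta * (alpha * rho / 2 + beta * rho + 2 * beta)
  + eta ^+ 2 * ((8 / s + 7) * (alpha ^+ 2 * rho ^+ 2) + 2 * beta ^+ 2 + 1).

Lemma err_coef_gt0 : 0 < err_coef.
Proof.
have b0 := beta_gt0; have a0 := alpha_gt0; have p0 := rho_gt0.
have n0 := eta_gt0; have /andP[s0 _] := s01.
rewrite /err_coef; positivity.
Qed.

Lemma err_coefE : r0 phi r * err_coef = eta * e8 + eta ^+ 2 * e9.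
Proof.
have /andP[s0 _] := s01.
rewrite /err_coef /eps8 /eps9.
have -> : 8 + 7 * phi * psi * r = 8 + 7 * s by rewrite !mulrA.
move: s0; set t := s => s0; by field; rewrite !gt_eqF.
Qed.

(** If [r0] is nonzero, the last entry of [kappa3] is the positive root of
    [eps9 t^2 + eps8 t - eps7]; squaring [2 eps9 eta + eps8] against the discriminant gives the
    sign. If [r0 = 0], [err_coefE] shows that the subtracted terms sum to zero. *)
Lemma eps789_gt0 : 0 < e7 - eta * e8 - eta ^+ 2 * e9.
Proof.
have n0 := eta_gt0.
have [rz|rnz] := eqVneq (r0 phi r) 0.
  have := err_coefE; rewrite rz mul0r => h.
  by rewrite -addrA -opprD -h subr0 eps7_gt0.
case/andP: heta => _; rewrite /kappa3 (negbTE rnz) lt_min => /andP[_].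
have r00 : 0 < r0 phi r by rewrite lt_neqAle eq_sym rnz r0_ge0.
have b0 := beta_gt0; have a0 := alpha_gt0; have p0 := rho_gt0.
have /andP[s0 _] := s01.
have e80 : 0 <= e8.
  rewrite /eps8; positivity.
have e90 : 0 < e9.
  rewrite /eps9; have -> : 8 + 7 * phi * psi * r = 8 + 7 * s by rewrite !mulrA.
  move: s0; set t := s => s0.
  rewrite ltr_wpDl //; last by positivity.
  by apply: mulr_ge0; positivity.
rewrite ltr_pdivlMr ?mulr_gt0 // ltrBrDr => h.
have e70 := eps7_gt0.
have q0 : 0 <= e8 ^+ 2 + 4 * e7 * e9.
  positivity.
have l0 : 0 <= eta * (2 * e9) + e8 by positivity.
have : (eta * (2 * e9) + e8) ^+ 2 < e8 ^+ 2 + 4 * e7 * e9.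
  by rewrite -[ltRHS](sqr_sqrtr q0) ltr_pXn2r // nnegrE ?sqrtr_ge0.
rewrite -subr_gt0.
have -> : e8 ^+ 2 + 4 * e7 * e9 - (eta * (2 * e9) + e8) ^+ 2 =
   4 * e9 * (e7 - eta * e8 - eta ^+ 2 * e9) by ring.
by rewrite pmulr_rgt0 // mulr_gt0.
Qed.

(* The bound [eta < eps1 / eps2] also controls the contributions of the step
   to the average iterate and to [z], which [eps4] and [eps6] miss. *)
Lemma eta_alpha_rho : eta * (8 / s + 7) * (alpha * rho) <= 2^-1.
Proof.
have a0 := alpha_gt0; have p0 := rho_gt0; have n0 := eta_gt0.
have ap : 0 < alpha * rho by rewrite mulr_gt0.
have h1 := ler_wpM2l (ltW n0) eps2_ge; have h2 := eta_eps2.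
have h3 : eps1 rho2 Lf alpha beta <= alpha * rho / 2.
  have := ler_wpM2l (ltW a0) rho2_le; have := beta_gt0; have := sqr_ge0 Lf.
  by rewrite /eps1; lra.
rewrite -(ler_pM2r ap).
move: h1; rewrite -exprMn; lra.
Qed.

(** Since [alpha rho >= 2], [eta_alpha_rho] leaves [eta (8 / s + 7) <= 1/4]. This controls the
    averaged part of the step inside the compression error, a term absent from [eps6]. *)
Lemma eta_rate_small : eta * (1 + 2 / s) <= 16^-1.
Proof.
have a0 := alpha_gt0; have p0 := rho_gt0; have n0 := eta_gt0.
have /andP[s0 _] := s01.
have ap : 2 <= alpha * rho.
  have := ler_wpM2l (ltW a0) rho2_le; have := alpha_rho2; have := beta_gt0.
  lra.
have q : 0 <= eta * (8 / s + 7).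
  positivity.
have := ler_wpM2l q ap; have := eta_alpha_rho; lra.
Qed.

(* [eps4] has [rho ^+ 2] where the estimate needs [rho]: for [rho < 1] the
   difference is absorbed thanks to [kappa1 >= 9 / (2 rho2) > 9 / 2]. *)
Lemma dual_coef_ge :
  eps3 rho2 beta - eta * e4 <=
  5 / 8 * beta - rho2^-1 - eta * (beta ^+ 2 * rho / 2 + rho2^-1)
   - eta * (2^-1 + (1 + 2 / s)) * (4 * (beta ^+ 2 * rho)).
Proof.
have a0 := alpha_gt0; have p0 := rho_gt0; have n0 := eta_gt0.
have b0 := beta_gt0.
have /andP[s0 s1] := s01.
have rV0 : 0 < rho2^-1 by rewrite invr_gt0.
have -> : e4 = 2 * beta ^+ 2 * rho + (8 / s + 4) * (beta ^+ 2 * rho ^+ 2) + rho2^-1.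
  by move: s0; rewrite /eps4; set q := s => s0; field; rewrite !gt_eqF.
have sV : 1 <= s^-1 by rewrite invf_ge1.
set t := s^-1 in sV *.
have key : eta * (8 * t + 7) * (kappa1 * (beta * rho)) <= 2^-1.
  by have := eta_alpha_rho; rewrite -/t; lra.
have nbr : 0 <= eta * (beta * rho) by rewrite !mulr_ge0 // ltW.
have k1 := kappa1_ge1.
rewrite /eps3.
suff : eta * (beta * rho) * (2^-1 + (8 * t + 4) * (1 - rho)) <= 8^-1.
  by move=> h; have := ler_wpM2l (ltW b0) h; lra.
have [rge|rlt] := leP 1 rho.
  have h1 : 15 <= (8 * t + 7) * kappa1.
    have : 15 * 1 <= (8 * t + 7) * kappa1 by apply: ler_pM => //; lra.
    by rewrite mulr1.
  have h2 := ler_wpM2l nbr h1.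
  have h3 : 0 <= eta * (beta * rho) * ((8 * t + 4) * (rho - 1)).
    by rewrite mulr_ge0 // mulr_ge0 //; lra.
  by lra.
have kr : 9 / 2 <= kappa1.
  have := kappa1_rho2; have : kappa1 * rho2 <= kappa1 * 1.
    apply: ler_wpM2l; first exact: le_trans ler01 k1.
    exact: le_trans rho2_le (ltW rlt).
  by move: kappa4_gt0; rewrite mulr1; lra.
have q : 0 <= eta * (beta * rho) * (8 * t + 7) by rewrite mulr_ge0 //; lra.
have h1 := ler_wpM2l q kr.
have h2 : 0 <= eta * (beta * rho) * ((8 * t + 4) * rho).
  by rewrite mulr_ge0 // mulr_ge0 //; lra.
by lra.
Qed.

(** The coefficient of the averaged gradient square: drift of [z], smoothness of the cost, and
    motion of the average inside the compression error, against the [eta / 2] gained by descent.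
    Twice [eta eps6 < eps5] bounds the first two by [eta / 4], and [eta_rate_small] bounds the last
    by [eta / 16]. *)
Lemma mean_coef_le :
  (eta * (2 * (kappa1 + 1) ^+ 2 / (beta * rho2) + rho2^-1 ^+ 2 / 2)
     + eta ^+ 2 * (3 / 4 * beta ^+ 2 + rho2^-1 ^+ 2 / 2
                   + (kappa1 + 1) / (2 * rho2))) * (Lf ^+ 2 / beta ^+ 2)
  + eta ^+ 2 * (Lf / 2) + eta ^+ 2 * (1 + 2 / s) <= eta / 2.
Proof.
have n0 := eta_gt0; have b0 := beta_gt0.
have := eta_eps6; rewrite /eps6 /eps5 .
have -> : (kappa1 * beta + beta) ^+ 2 * Lf ^+ 2 / (beta ^+ 5 * rho2) =
   (kappa1 + 1) ^+ 2 / (beta * rho2) * (Lf ^+ 2 / beta ^+ 2).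
  by field; rewrite !gt_eqF.
have -> : (kappa1 * beta + beta) * Lf ^+ 2 / (2 * beta ^+ 3 * rho2) =
   (kappa1 + 1) / (2 * rho2) * (Lf ^+ 2 / beta ^+ 2).
  by field; rewrite !gt_eqF.
have -> : Lf ^+ 2 / (2 * beta ^+ 2 * rho2 ^+ 2) =
    rho2^-1 ^+ 2 / 2 * (Lf ^+ 2 / beta ^+ 2).
  by field; rewrite !gt_eqF.
have eL : Lf ^+ 2 = beta ^+ 2 * (Lf ^+ 2 / beta ^+ 2).
  by field; rewrite !gt_eqF.
have T0 : 0 <= Lf ^+ 2 / beta ^+ 2 by rewrite divr_ge0 ?sqr_ge0.
have -> : 3 * Lf ^+ 2 / 4 = 3 / 4 * beta ^+ 2 * (Lf ^+ 2 / beta ^+ 2).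
  by field; rewrite !gt_eqF.
have h := eta_rate_small.
set T := Lf ^+ 2 / beta ^+ 2 in T0 *.
have a0 : 0 <= (kappa1 + 1) ^+ 2 / (beta * rho2) * T.
  have r2 := rho2_gt0; positivity.
have b1 : 0 <= rho2^-1 ^+ 2 / 2 * T by positivity.
have k1 := kappa1_ge1.
have c1 : 0 <= eta * ((kappa1 + 1) / (2 * rho2) * T).
  have k0 : 0 <= kappa1 := le_trans ler01 k1.
  have r2 := rho2_gt0; positivity.
have c2 : 0 <= eta * (3 / 4 * beta ^+ 2 * T) by positivity.
have c3 : 0 <= eta * (rho2^-1 ^+ 2 / 2 * T) by positivity.
have l0 := Lf_gt0; have c4 : 0 <= eta * (Lf / 2) by positivity.
move: a0 b1 c1 c2 c3 c4 h.
have -> : 2 * (kappa1 + 1) ^+ 2 / (beta * rho2) =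
   2 * ((kappa1 + 1) ^+ 2 / (beta * rho2)) by rewrite !mulrA.
set A := _ / (beta * rho2); set B := _ / (2 * rho2); set C := _ ^+ 2 / 2.
move=> a0 b1 c1 c2 c3 c4 h h0.
suff : (2 * A + C) * T + eta * (3 / 4 * beta ^+ 2 + C + B) * T + eta * (Lf / 2)
   + eta * (1 + 2 / s) <= 2^-1.
  by move=> /(ler_wpM2l (ltW n0)); lra.
by lra.
Qed.


(** * The rate and the scalar contraction estimate *)

Local Notation e11 := (eps11 rho2 alpha beta).
Local Notation e12 := (eps12 rho rho2 Lf nu phi r alpha beta eta psi).
Local Notation eps := (epsilon rho rho2 Lf nu phi r alpha beta eta psi).

Lemma eps11_ge : 3 / 2 <= e11.
Proof.
have b0 := beta_gt0; rewrite /eps11 le_max; apply/orP; left.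
by rewrite mulfK ?gt_eqF //; have := kappa1_ge1; lra.
Qed.

Lemma eps12_le : [/\ e12 <= eta * (eps1 rho2 Lf alpha beta - eta * e2),
  e12 <= eta * (eps3 rho2 beta - eta * e4), e12 <= eta * nu
  & e12 <= e7 - eta * e8 - eta ^+ 2 * e9].
Proof.
have n0 := eta_gt0; have v0 := nu_gt0.
have -> : e7 - eta * e8 - eta ^+ 2 * e9 = eta * (e7 / eta - e8 - eta * e9).
  by field; rewrite gt_eqF.
have h : nu / 2 <= nu by lra.
rewrite /eps12 !(ler_pM2l n0) !ge_min !lexx ?orbT; split=> //.
by rewrite h !orbT.
Qed.

Lemma eps12_gt0 : 0 < e12.
Proof.
have n0 := eta_gt0; have v0 := nu_gt0.
rewrite /eps12 pmulr_rgt0 // !lt_min !subr_gt0 eta_eps2 eta_eps4 divr_gt0 //=.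
have := eps789_gt0.
have -> : e7 - eta * e8 - eta ^+ 2 * e9 = eta * (e7 / eta - e8 - eta * e9).
  by field; rewrite gt_eqF.
by rewrite pmulr_rgt0 // subr_gt0.
Qed.

(** [eps12] is at most [eps7 <= 1] through its last entry, while [eps11 >= 3/2]. *)
Lemma epsilon01 : 0 < eps < 1.
Proof.
have h11 := eps11_ge; have e0 : 0 < e11 by lra.
rewrite /epsilon divr_gt0 ?eps12_gt0 //= ltr_pdivrMr // mul1r.
have [_ _ _ h] := eps12_le.
have := mulr_ge0 r0_ge0 (ltW err_coef_gt0); rewrite err_coefE.
by have := eps7_le1; lra.
Qed.

(** The decrease is at least [eps12 (X + B + W + D)], and [V] is at most [eps11] times the same sum;
    hence the ratio [eps12 / eps11]. *)
Lemma contraction (V X B W D : R) : 0 <= X -> 0 <= B -> 0 <= W -> 0 <= D ->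
  V <= e11 * (X + B + W + D) ->
  V - eta * (eps1 rho2 Lf alpha beta - eta * e2) * X
    - eta * (eps3 rho2 beta - eta * e4) * B - eta * nu * W
    - (e7 - eta * e8 - eta ^+ 2 * e9) * D <= (1 - eps) * V.
Proof.
move=> X0 B0 W0 D0 hV.
have [h1 h2 h3 h4] := eps12_le.
have := ler_wpM2r X0 h1; have := ler_wpM2r B0 h2; have := ler_wpM2r W0 h3.
have := ler_wpM2r D0 h4.
have h11 := eps11_ge; have e0 : 0 < e11 by lra.
have /andP[p0 _] := epsilon01; have := ler_wpM2l (ltW p0) hV.
by rewrite mulrA [eps * e11]divfK ?gt_eqF //; lra.
Qed.

(** The constant [c] of the overview: the first term comes from the bound on the error [e], the
    second from the convexity bound on [y - psi q]. *)
Definition gap_coef : R :=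
  2 * r ^+ 2 * err_coef + (1 + s / 2) * (psi * r).

Lemma gap_coef_ge0 : 0 <= gap_coef.
Proof.
have c0 := err_coef_gt0; have /andP[s0 _] := s01; have /andP[p0 _] := psir01.
rewrite /gap_coef; positivity.
Qed.

(** All the arithmetic of one step. [X], [E], [P], [H] stand for the squares of [K x], [e], the
    drive [p] and the averaged gradients, [B] for [<z, L z>], and [D], [G], [Y] for [|y|^2],
    [|q / r - y|^2], [|y - psi q|^2]. Once [gap_coef (1 - phi) D] is added on the left, the weight
    of [D] is [1 - eps7 + r0 err_coef]. *)
Lemma lyap_contraction (PD PD' W W' D D' X B E P H Y G : R) :
  0 <= X -> 0 <= E -> 0 <= B -> 0 <= W -> 0 <= D -> 0 <= H ->
  PD' <= PD
  - (eta * (alpha * rho2 / 2 - 9 / 8 * beta - 1 - 3 / 4 * Lf ^+ 2)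
     - eta ^+ 2 * (2 * beta ^+ 2 + 1 + Lf ^+ 2)) * X
  + (eta * (alpha * rho / 2 + 2 * beta + beta * rho)
     + eta ^+ 2 * (2 * beta ^+ 2 + 1)) * E
  - (eta * (5 / 8 * beta - rho2^-1)
     - eta ^+ 2 * (beta ^+ 2 * rho / 2 + rho2^-1)) * B
  + eta ^+ 2 / 2 * P
  + (eta * (2 * (kappa1 + 1) ^+ 2 / (beta * rho2) + rho2^-1 ^+ 2 / 2)
     + eta ^+ 2 * (3 / 4 * beta ^+ 2 + rho2^-1 ^+ 2 / 2
                   + (kappa1 + 1) / (2 * rho2))) * (Lf ^+ 2 / beta ^+ 2 * H) ->
  W' <= W - eta / 2 * H - eta * nu * W + eta / 2 * (Lf ^+ 2 * X)
        + eta ^+ 2 * (Lf / 2) * H ->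
  D' <= (1 + s / 2) * Y + (1 + 2 / s) * (eta ^+ 2 * (P + H)) ->
  P <= 4 * (alpha ^+ 2 * rho ^+ 2 * (X + E) + beta ^+ 2 * rho * B + Lf ^+ 2 * X) ->
  E <= 2 * r ^+ 2 * G + 2 * (1 - r) ^+ 2 * D ->
  Y <= (1 - psi * r) * D + psi * r * G ->
  PD + W + D <= e11 * (X + B + W + D) ->
  PD' + W' + D' + gap_coef * ((1 - phi) * D)
    <= (1 - eps) * (PD + W + D) + gap_coef * G.
Proof.
move=> X0 E0 B0 W0 D0 H0 hPD hW hD hP hE hY hV.
have /andP[s0 _] := s01; have n0 := eta_gt0; have b0 := beta_gt0.
have := contraction X0 B0 W0 D0 hV.
have -> : e7 - eta * e8 - eta ^+ 2 * e9 = e7 - r0 phi r * err_coef.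
  by rewrite err_coefE; ring.
have {}hE := ler_wpM2l (ltW err_coef_gt0) hE.
have p0 : 0 <= 1 + s / 2 by positivity.
have {}hY := ler_wpM2l p0 hY.
have hB := ler_wpM2r (mulr_ge0 (ltW n0) B0) dual_coef_ge.
have hH := ler_wpM2r H0 mean_coef_le.
have q0 : 0 <= eta ^+ 2 / 2 + (1 + 2 / s) * eta ^+ 2 by positivity.
have {}hP := ler_wpM2l q0 hP.
have e2E : e2 = 3 * Lf ^+ 2 + (8 / s + 4) * (alpha ^+ 2 * rho ^+ 2 + Lf ^+ 2)
    + 2 * beta ^+ 2 + 1 + 3 * alpha ^+ 2 * rho ^+ 2.
  by move: s0; rewrite /eps2; set t := s => s0; field; rewrite gt_eqF.
rewrite e2E /gap_coef /r0 /eps7 /eps1.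
(* The slack between estimates and constants: [eps1] charges [9/4 beta] where [9/8 beta] is spent,
   and [eps2] and [err_coef] charge [8 / s + 7] where [8 / s + 6] is spent on [(alpha rho)^2]. *)
have g0 : 0 <= eta * (9 / 8 * beta * X) by positivity.
have g1 : 0 <= eta ^+ 2 * (alpha ^+ 2 * rho ^+ 2 * X) by positivity.
have g2 : 0 <= eta ^+ 2 * (alpha ^+ 2 * rho ^+ 2 * E) by positivity.
clear e2E p0 q0 hV s0 n0 b0.
have ec : err_coef = eta * (alpha * rho / 2 + beta * rho + 2 * beta)
  + eta ^+ 2 * ((8 / s + 7) * (alpha ^+ 2 * rho ^+ 2) + 2 * beta ^+ 2 + 1) by [].
have ecE := congr1 (fun t => t * E) ec.
move: ecE hE hY hB hH hP hD hW hPD g0 g1 g2.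
set t := s^-1; set m := rho2^-1; set k2 := 2 * (kappa1 + 1) ^+ 2 / _.
set k3 := (kappa1 + 1) / _; set l := Lf ^+ 2 / beta ^+ 2.
set c := err_coef; set a3 := eps3 _ _; set a4 := eps4 _ _ _ _ _ _.
move=> *; lra.
Qed.

End StepSizes.

(** * Spectrum of the Laplacian *)

Lemma mxdot_eq0 (R : realFieldType) n d (X : 'M[R]_(n, d)) :
  mxdot X X = 0 -> X = 0.
Proof.
rewrite mxdotE => /eqP; rewrite psumr_eq0; last first.
  by move=> i _; apply: sumr_ge0 => j _; rewrite -expr2 sqr_ge0.
move=> /allP h; apply/matrixP => i j; rewrite mxE.
have := h i (mem_index_enum i); rewrite /= psumr_eq0; last first.
  by move=> l _; rewrite -expr2 sqr_ge0.
by move=> /allP/(_ j (mem_index_enum j)); rewrite /= mulf_eq0 orbb => /eqP.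
Qed.

Section Rayleigh.
Variables (R : realType) (n : nat).

Lemma continuous_mxdot_mul (A B : 'M[R]_n) :
  continuous (fun v : 'rV[R]_n => mxdot (v *m A) (v *m B)).
Proof.
move=> v; rewrite (_ : (fun _ => _) = fun v : 'rV[R]_n =>
   \sum_(i < 1) \sum_(j < n) (\sum_(k < n) v i k * A k j)
                           * (\sum_(k < n) v i k * B k j)); last first.
  apply/funext => w; rewrite mxdotE; apply: eq_bigr => i _.
  by apply: eq_bigr => j _; rewrite !mxE.
move: v; apply: continuous_big => //; first exact: add_continuous.
move=> i _.
have c (M : 'M[R]_n) j : continuous (fun v : 'rV[R]_n => \sum_(k < n) v i k * M k j).
  apply: continuous_big; first exact: add_continuous.
  by move=> k _ v; apply: continuousM; [exact: coord_continuous|exact: cst_continuous].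
apply: continuous_big; first exact: add_continuous.
by move=> j _ v; apply: continuousM; exact: c.
Qed.

(** A minimiser of the Rayleigh quotient on the unit sphere of [ker M] is an eigenvector: its
    residual stays in [ker M] by invariance, so it is an admissible variation. With [M = J] this
    gives the spectral gap, with [M = 0] and [- L] the largest eigenvalue. Row vectors match the
    left action in [eigenvalue]. *)
Lemma rayleigh_min (S M : 'M[R]_n) (v0 : 'rV[R]_n) :
  S^T = S -> (forall v : 'rV[R]_n, v *m M = 0 -> v *m S *m M = 0) ->
  v0 != 0 -> v0 *m M = 0 ->
  exists a : R, [/\ eigenvalue S a,
    exists2 v : 'rV[R]_n, v != 0 /\ v *m M = 0 & v *m S = a *: v
    & forall w : 'rV[R]_n, w *m M = 0 -> a * mxdot w w <= mxdot w (w *m S)].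
Proof.
move=> Ssym SM v00 v0M.
(* The factor [1%:M] and the squared norm of [v *m M] make both constraints instances of
   [continuous_mxdot_mul]. *)
pose N := [set v : 'rV[R]_n | mxdot (v *m 1%:M) (v *m 1%:M) = 1] `&`
  [set v : 'rV[R]_n | mxdot (v *m M) (v *m M) = 0].
have Ncl : closed N.
  apply: closedI.
    apply: (@closed_comp _ _ (fun v : 'rV[R]_n => mxdot (v *m 1%:M) (v *m 1%:M))
      [set x | x = 1]); last exact: closed_eq.
    by move=> v _; exact: continuous_mxdot_mul.
  apply: (@closed_comp _ _ (fun v : 'rV[R]_n => mxdot (v *m M) (v *m M))
    [set x | x = 0]); last exact: closed_eq.
  by move=> v _; exact: continuous_mxdot_mul.
have box : compact [set v : 'rV[R]_n | forall i, `[(- 1), 1]%classic (v ord0 i)].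
  have := @rV_compact R n (fun=> `[(- 1 : R), 1]%classic); apply.
  by move=> _; apply: segment_compact.
have Ncpt : compact N.
  apply: subclosed_compact Ncl box _ => v [/= + _] i.
  rewrite mulmx1 mxdotE big_ord1 (bigD1 i) //= => h.
  suff : `|v ord0 i| <= 1 by rewrite /= in_itv /= -ler_norml.
  rewrite -(@expr_le1 _ 2) // real_normK ?num_real // expr2 -h lerDl.
  by apply: sumr_ge0 => j _; rewrite -expr2 sqr_ge0.
have sc (w : 'rV[R]_n) : w != 0 -> 0 < mxdot w w.
  move=> w0; rewrite lt_neqAle mxdot_ge0 andbT eq_sym.
  by apply: contra w0 => /eqP/mxdot_eq0 ->.
have Nsc (w : 'rV[R]_n) : w != 0 -> w *m M = 0 ->
    N ((Num.sqrt (mxdot w w))^-1 *: w).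
  move=> w0 wM; have wp := sc _ w0; split => /=.
    rewrite mulmx1 mxdotZl mxdotZr mulrA -invfM -expr2 sqr_sqrtr ?(ltW wp) //.
    by rewrite mulVf // gt_eqF.
  by rewrite -scalemxAl wM scaler0 mxdot0l.
have N0 : N !=set0 by eexists; exact: Nsc v00 v0M.
have fcont : {within N, continuous (fun v : 'rV[R]_n => mxdot (v *m 1%:M) (v *m S))}.
  by apply: continuous_subspaceT; exact: continuous_mxdot_mul.
have [v /set_mem[/= v1 vM] vmin] := EVT_min_rV N0 Ncpt fcont.
rewrite mulmx1 in v1; have {}vM := mxdot_eq0 vM.
pose a := mxdot v (v *m S); exists a.
have amin (w : 'rV[R]_n) : w *m M = 0 -> a * mxdot w w <= mxdot w (w *m S).
  move=> wM; have [->|w0] := eqVneq w 0.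
    by rewrite mul0mx mxdot0l mulr0.
  have := vmin _ (mem_set (Nsc _ w0 wM)).
  rewrite !mulmx1 -/a -scalemxAl mxdotZl mxdotZr mulrA -invfM -expr2.
  rewrite sqr_sqrtr ?mxdot_ge0 // mulrC ler_pdivlMr //; exact: sc.
have vn0 : v != 0.
  apply/eqP => vz; move: v1; rewrite vz mxdot0l => /eqP.
  by rewrite eq_sym oner_eq0.
have Ssw (x y : 'rV[R]_n) : mxdot x (y *m S) = mxdot y (x *m S).
  by rewrite mxdotC /mxdot trmx_mul Ssym -mulmxA.
have vS : v *m S = a *: v.
  (* [u] is the residual; minimality along [v + t u] forces [2 t |u|^2 + c t^2 >= 0] for all [t]. *)
  have [u uE] : exists u, u = v *m S - a *: v by eexists.
  have uM : u *m M = 0 by rewrite uE mulmxBl SM // -scalemxAl vM scaler0 subr0.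
  have uv : mxdot u (v *m S) - a * mxdot u v = mxdot u u.
    by rewrite {4}uE mxdotDr mxdotNr mxdotZr.
  have c0 : 0 <= mxdot u (u *m S) - a * mxdot u u by rewrite subr_ge0 amin.
  set c := _ - _ in c0; set N2 := mxdot u u in uv.
  have h t : 0 <= 2 * t * N2 + t ^+ 2 * c.
    have := amin (v + t *: u); rewrite mulmxDl -scalemxAl vM uM scaler0 addr0.
    move=> /(_ erefl); rewrite mulmxDl -scalemxAl !mxdot_lin.
    rewrite (Ssw v u) (mxdotC v u) v1 -/a -/N2 -subr_ge0; congr (0 <= _).
    have uv' : mxdot u (v *m S) = N2 + a * mxdot u v by rewrite -uv subrK.
    by rewrite uv' /c; ring.
  have c1 : 0 < c + 1 by lra.
  (* The shift by 1 in the choice of [t] also covers [c = 0]. *)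
  have := h (- (N2 / (c + 1))).
  have -> : 2 * - (N2 / (c + 1)) * N2 + (- (N2 / (c + 1))) ^+ 2 * c =
     - ((N2 / (c + 1)) ^+ 2 * (c + 2)).
    by field; rewrite gt_eqF.
  rewrite oppr_ge0 => h1.
  have : (N2 / (c + 1)) ^+ 2 = 0.
    apply/eqP; rewrite eq_le sqr_ge0 andbT.
    by rewrite -(pmulr_lle0 _ (_ : 0 < c + 2)) //; lra.
  move/eqP; rewrite expf_eq0 /= mulf_eq0 invr_eq0 (gt_eqF c1) orbF => /eqP.
  by move/mxdot_eq0; rewrite uE => /eqP; rewrite subr_eq0 => /eqP.
split=> //; last by exists v.
by apply/eigenvalueP; exists v.
Qed.

(** [sup] needs an upper bound of the set: eigenvalues are roots of the characteristic polynomial,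
    so the sum of the moduli of its roots bounds each of them. *)
Lemma normc_eigenvalue_le_radius (M : 'M[R]_n) (z : R[i]) :
  eigenvalue (map_mx (real_complex R) M) z ->
  ComplexField.Normc.normc z <= spectral_radius M.
Proof.
move=> hz; apply: ub_le_sup; last by exists z.
set P := char_poly (map_mx (real_complex R) M).
have [s sE] := closed_field_poly_normal P.
exists (\sum_(x <- s) ComplexField.Normc.normc x) => _ [x hx <-].
have : root P x by rewrite /P -eigenvalue_root_char.
rewrite sE (monicP (char_poly_monic _)) scale1r.
rewrite root_prod_XsubC => xs.
rewrite (big_rem x) //= lerDl; apply: sumr_ge0 => y _.
by case: y => p q /=; rewrite sqrtr_ge0.
Qed.

Lemma eigenvalue_le_radius (M : 'M[R]_n) (a : R) :
  eigenvalue M a -> a <= spectral_radius M.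
Proof.
move=> ha; apply: le_trans (ler_norm a) _.
have -> : `|a| = ComplexField.Normc.normc (real_complex R a).
  by rewrite /= expr0n addr0 sqrtr_sqr.
by apply: normc_eigenvalue_le_radius; rewrite eigenvalue_map.
Qed.

End Rayleigh.

(** * Kernel, spectral bounds and pseudo-inverse of the Laplacian *)

Definition avg_mx (R : realType) (n : nat) : 'M[R]_n := const_mx n%:R^-1.

Section Laplacian.
Variables (R : realType) (n : nat) (A : 'M[R]_n).
Hypotheses (n_ge2 : (2 <= n)%N) (hA : is_adjacency A)
  (hconn : graph_connected A).
Local Notation L := (laplacian A).
Local Notation J := (avg_mx R n).

Lemma avg_mx_sym : J^T = J.
Proof. by apply/matrixP => i j; rewrite !mxE. Qed.

Lemma avg_mx_mulE d (X : 'M[R]_(n, d)) i j :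
  (J *m X) i j = n%:R^-1 * \sum_k X k j.
Proof. by rewrite mxE mulr_sumr; apply: eq_bigr => k _; rewrite mxE. Qed.

Lemma natn_neq0 : n%:R != 0 :> R.
Proof. by rewrite pnatr_eq0 -lt0n (leq_trans _ n_ge2). Qed.

Lemma avg_mx_id : J *m J = J.
Proof.
apply/matrixP => i j; rewrite avg_mx_mulE !mxE.
under eq_bigr do rewrite mxE.
by rewrite sumr_const card_ord -[X in _ * X = _]mulr_natr mulVf ?natn_neq0 // mulr1.
Qed.

Lemma laplacian_sym : L^T = L.
Proof.
case: hA => AT _ _; apply/matrixP => i j; rewrite !mxE.
have -> : A j i = A i j by rewrite -[in LHS]AT mxE.
by congr (_ - _); case: eqVneq => [->|]; rewrite ?eqxx // eq_sym => /negbTE ->.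
Qed.

Lemma laplacian_mulE d (X : 'M[R]_(n, d)) i j :
  (L *m X) i j = \sum_k A i k * (X i j - X k j).
Proof.
rewrite mulmxBl mul_diag_mx !mxE mulr_suml.
by rewrite -sumrB; apply: eq_bigr => k _; rewrite mulrBr.
Qed.

Lemma laplacian_avg : L *m J = 0.
Proof.
apply/matrixP => i j; rewrite laplacian_mulE [RHS]mxE big1 // => k _.
by rewrite !mxE subrr mulr0.
Qed.

Lemma avg_laplacian : J *m L = 0.
Proof.
by rewrite -[LHS]trmxK trmx_mul avg_mx_sym laplacian_sym laplacian_avg trmx0.
Qed.

(** Exchanging [i] and [k] and using the symmetry of [A] gives a second expression for the form; the
    two are averaged. *)
Lemma laplacian_form d (X : 'M[R]_(n, d)) : mxdot X (L *m X) =
  2^-1 * \sum_j \sum_i \sum_k A i k * (X i j - X k j) ^+ 2.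
Proof.
case: hA => AT _ _.
have As i k : A k i = A i k by rewrite -[in LHS]AT mxE.
rewrite mxdotE exchange_big mulr_sumr; apply: eq_bigr => j _.
have e : \sum_i X i j * (L *m X) i j =
    \sum_i \sum_k A i k * (X i j - X k j) * X i j.
  apply: eq_bigr => i _; rewrite laplacian_mulE mulrC mulr_suml.
  by apply: eq_bigr.
have e' : \sum_i X i j * (L *m X) i j =
    \sum_i \sum_k A i k * (X k j - X i j) * X k j.
  rewrite e exchange_big; apply: eq_bigr => i _; apply: eq_bigr => k _.
  by rewrite As.
have : \sum_i X i j * (L *m X) i j + \sum_i X i j * (L *m X) i j =
    \sum_i \sum_k A i k * (X i j - X k j) ^+ 2.
  rewrite {1}e e' -big_split; apply: eq_bigr => i _ /=.
  rewrite -big_split; apply: eq_bigr => k _ /=; ring.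
by move=> <-; field.
Qed.

Lemma laplacian_psd d (X : 'M[R]_(n, d)) : 0 <= mxdot X (L *m X).
Proof.
case: hA => _ A0 _; rewrite laplacian_form mulr_ge0 ?invr_ge0 //.
apply: sumr_ge0 => j _; apply: sumr_ge0 => i _; apply: sumr_ge0 => k _.
by rewrite mulr_ge0 ?sqr_ge0.
Qed.

(** A vanishing sum of nonnegative terms makes [X] constant across each edge, and a path carries
    this to every pair of vertices. *)
Lemma laplacian_form_eq0 d (X : 'M[R]_(n, d)) :
  mxdot X (L *m X) = 0 -> X = J *m X.
Proof.
case: hA => _ A0 _; rewrite laplacian_form => /eqP.
rewrite mulf_eq0 invr_eq0 pnatr_eq0 /=.
have p0 i k j : 0 <= A i k * (X i j - X k j) ^+ 2 by rewrite mulr_ge0 ?sqr_ge0.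
have p1 i j : 0 <= \sum_k A i k * (X i j - X k j) ^+ 2 by apply: sumr_ge0.
have p2 j : 0 <= \sum_i \sum_k A i k * (X i j - X k j) ^+ 2 by apply: sumr_ge0.
rewrite psumr_eq0 // => /allP h.
have edge i k j : 0 < A i k -> X i j = X k j.
  move=> aik; have := h j (mem_index_enum j); rewrite /= psumr_eq0 //.
  move=> /allP/(_ i (mem_index_enum i)); rewrite /= psumr_eq0 //.
  move=> /allP/(_ k (mem_index_enum k)); rewrite /= mulf_eq0 gt_eqF //=.
  by rewrite expf_eq0 /= subr_eq0 => /eqP.
have all_eq i k j : X i j = X k j.
  have /connectP[p] := hconn i k.
  elim: p i => [i _ ->//|x p IH i /= /andP[e pth] lst].
  by rewrite (edge _ _ _ e); exact: IH.
apply/matrixP => i j; rewrite avg_mx_mulE.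
under eq_bigr do rewrite (all_eq _ i).
by rewrite sumr_const card_ord -[X in _ = _ * X]mulr_natl mulrA mulVf ?natn_neq0 // mul1r.
Qed.

Lemma mxdot_cols d (X Y : 'M[R]_(n, d)) :
  mxdot X Y = \sum_j mxdot (col j X)^T (col j Y)^T.
Proof.
rewrite mxdotE exchange_big; apply: eq_bigr => j _.
by rewrite mxdotE big_ord1; apply: eq_bigr => i _; rewrite !mxE.
Qed.

Lemma tr_col_mul (M : 'M[R]_n) d (X : 'M[R]_(n, d)) j :
  M^T = M -> (col j (M *m X))^T = (col j X)^T *m M.
Proof. by move=> sM; rewrite !colE -mulmxA trmx_mul sM. Qed.

Lemma mxdot_row_form (v : 'rV[R]_n) (M : 'M[R]_n) : M^T = M ->
  mxdot v (v *m M) = mxdot v^T (M *m v^T).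
Proof.
by move=> sM; rewrite /mxdot !trmx_mul trmxK sM mulmxA mxtrace_mulC.
Qed.

(** [a] is the minimum over row vectors of zero sum. If it were zero, the minimiser would be
    constant of zero mean, hence null. An eigenvector of a positive eigenvalue has zero sum because
    [L *m J = 0], so it competes in the minimum. *)
Lemma laplacian_gap_eigen : exists a : R, [/\ 0 < a, eigenvalue L a,
  (forall b, 0 < b -> eigenvalue L b -> a <= b)
  & forall d (X : 'M[R]_(n, d)), J *m X = 0 -> a * mxdot X X <= mxdot X (L *m X)].
Proof.
have [i0 [i1 ne]] : exists i0 i1 : 'I_n, i0 != i1.
  by exists (Ordinal (leq_trans (ltnSn 0) (ltnW n_ge2))), (Ordinal n_ge2).
(* Two distinct vertices provide a nonzero vector of zero sum. *)
pose v0 : 'rV[R]_n := delta_mx 0 i0 - delta_mx 0 i1.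
have v00 : v0 != 0.
  apply/eqP => /matrixP/(_ 0 i0); rewrite !mxE !eqxx (negbTE ne) /= subr0.
  by move/eqP; rewrite oner_eq0.
have v0J : v0 *m J = 0.
  by apply/matrixP => i j; rewrite mulmxBl -!rowE !mxE subrr.
have inv (v : 'rV[R]_n) : v *m J = 0 -> v *m L *m J = 0.
  by rewrite -mulmxA laplacian_avg mulmx0.
have [a [ea [v [vn0 vJ] vL] amin]] := rayleigh_min laplacian_sym inv v00 v0J.
have sc (w : 'rV[R]_n) : w != 0 -> 0 < mxdot w w.
  move=> w0; rewrite lt_neqAle mxdot_ge0 andbT eq_sym.
  by apply: contra w0 => /eqP/mxdot_eq0 ->.
have va : a * mxdot v v = mxdot v^T (L *m v^T).
  by rewrite -mxdot_row_form ?laplacian_sym // vL mxdotZr.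
have a0 : 0 < a.
  rewrite lt_neqAle; apply/andP; split; last first.
    by rewrite -(pmulr_lge0 _ (sc _ vn0)) va laplacian_psd.
  apply: contra vn0 => /eqP az; rewrite -trmx_eq0.
  rewrite (laplacian_form_eq0 (_ : mxdot v^T (L *m v^T) = 0)) -?va -?az ?mul0r //.
  by rewrite -avg_mx_sym -trmx_mul vJ trmx0.
exists a; split=> //.
  move=> b b0 /eigenvalueP[u uL u0].
  have uJ : u *m J = 0.
    have := congr1 (fun w => w *m J) uL.
    rewrite /= -mulmxA laplacian_avg mulmx0 -scalemxAl => /esym/eqP.
    by rewrite scaler_eq0 (gt_eqF b0) /= => /eqP.
  by have := amin u uJ; rewrite uL mxdotZr ler_pM2r ?sc.
move=> d X JX; rewrite !(mxdot_cols X) mulr_sumr.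
apply: ler_sum => j _; rewrite tr_col_mul ?laplacian_sym //; apply: amin.
by rewrite -tr_col_mul ?avg_mx_sym // JX; apply/matrixP => i k; rewrite !mxE.
Qed.

Local Notation rho2 := (min_pos_eigenvalue L).
Local Notation rho := (spectral_radius L).

Lemma min_pos_eigenvalueP : [/\ 0 < rho2, eigenvalue L rho2
  & forall d (X : 'M[R]_(n, d)),
      J *m X = 0 -> rho2 * mxdot X X <= mxdot X (L *m X)].
Proof.
have [a [a0 ea al ag]] := laplacian_gap_eigen.
suff -> : rho2 = a by [].
apply/eqP; rewrite eq_le; apply/andP; split.
  by apply: ge_inf => //; exists 0 => b /= [/ltW].
apply: lb_le_inf; first by exists a.
by move=> b /= [b0 eb]; exact: al.
Qed.

Lemma min_pos_eigenvalue_le_radius : rho2 <= rho.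
Proof. by have [_ e _] := min_pos_eigenvalueP; exact: eigenvalue_le_radius. Qed.

(** The least eigenvalue of [- L], with no constraint, is minus the largest eigenvalue of [L], which
    the spectral radius dominates. *)
Lemma laplacian_le_radius d (X : 'M[R]_(n, d)) :
  mxdot X (L *m X) <= rho * mxdot X X.
Proof.
have v00 : const_mx 1 != 0 :> 'rV[R]_n.
  apply/eqP => /matrixP/(_ 0 (Ordinal n_ge2)); rewrite !mxE => /eqP.
  by rewrite oner_eq0.
have sN : (- L)^T = - L by rewrite linearN /= laplacian_sym.
have [||a [/eigenvalueP[v vL v0] _ amin]] :=
  @rayleigh_min R n (- L) 0 (const_mx 1) sN _ v00.
- by move=> v _; rewrite mulmx0.
- by rewrite mulmx0.
have na : - a <= rho.
  apply: eigenvalue_le_radius; apply/eigenvalueP; exists v => //.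
  by rewrite scaleNr -vL mulmxN opprK.
rewrite !(mxdot_cols X) mulr_sumr; apply: ler_sum => j _.
rewrite tr_col_mul ?laplacian_sym //.
have := amin (col j X)^T (mulmx0 _ _); rewrite mulmxN mxdotNr => h.
have := ler_wpM2r (mxdot_ge0 (col j X)^T) na; lra.
Qed.

(** [Q = (L + J)^-1 K]. To invert [L + J], multiply [v (L + J) = 0] by [J]: this gives [v J = 0],
    then [v L = 0], so [v] is constant of zero mean. *)
Lemma laplacian_pinv : exists Q : 'M[R]_n, L *m Q = 1%:M - J /\ J *m Q = 0.
Proof.
pose M := L + J.
have uM : M \in unitmx.
  rewrite -row_free_unit -kermx_eq0; apply/eqP/row_matrixP => i.
  rewrite row0; set v := row i _.
  have vM : v *m M = 0.
    by rewrite /v -row_mul mulmx_ker row0.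
  have vJ : v *m J = 0.
    have := congr1 (fun w => w *m J) vM.
    by rewrite /= mul0mx -mulmxA mulmxDl laplacian_avg add0r avg_mx_id.
  have vL : v *m L = 0 by move: vM; rewrite mulmxDr vJ addr0.
  apply: trmx_inj; rewrite trmx0.
  rewrite (laplacian_form_eq0 (_ : mxdot v^T (L *m v^T) = 0)).
    by rewrite -avg_mx_sym -trmx_mul vJ trmx0.
  by rewrite -mxdot_row_form ?laplacian_sym // vL mxdotC mxdot0l.
have JV : J *m invmx M = J.
  have JM : J *m M = J by rewrite mulmxDr avg_laplacian add0r avg_mx_id.
  by rewrite -[in LHS]JM mulmxK.
exists (invmx M *m (1%:M - J)); split; last first.
  by rewrite mulmxA JV mulmxBr mulmx1 avg_mx_id subrr.
have -> : L = M - J by rewrite addrK.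
rewrite mulmxA mulmxBl mulmxV // JV mulmxBl mul1mx mulmxBr mulmx1 avg_mx_id.
by rewrite subrr subr0.
Qed.

End Laplacian.

(** * Smooth functions *)

Section Smooth.
Variables (R : realType) (d : nat).
Implicit Types (f : 'rV[R]_d -> R) (x y v : 'rV[R]_d).

Lemma enorm_sqr x : enorm x ^+ 2 = mxdot x x.
Proof.
rewrite mxdotE big_ord1 /enorm sqr_sqrtr.
  by apply: eq_bigr => j _; rewrite expr2.
by apply: sumr_ge0 => j _; exact: sqr_ge0.
Qed.

Lemma enorm_ge0 x : 0 <= enorm x. Proof. exact: sqrtr_ge0. Qed.

Lemma derive_grad f x v : differentiable f x -> 'D_v f x = mxdot (grad f x) v.
Proof.
move=> df; rewrite deriveE // {1}(row_sum_delta v) linear_sum mxdotE big_ord1.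
by apply: eq_bigr => j _; rewrite linearZ /= -deriveE // !mxE mulrC.
Qed.

Lemma is_derive_line f x v (t : R) : (forall y, differentiable f y) ->
  is_derive t 1 (fun s : R => f (x + s *: v)) (mxdot (grad f (x + t *: v)) v).
Proof.
move=> df; rewrite -derive_grad //.
have e : (fun h : R => h^-1 *: (((fun s : R => f (x + s *: v)) \o shift t) (h *: 1)
    - f (x + t *: v))) =
  (fun h : R => h^-1 *: ((f \o shift (x + t *: v)) (h *: v) - f (x + t *: v))).
  apply/funext => h /=; congr (_ *: (f _ - _)).
  by rewrite scalerDl [h *: 1]mulr1 addrCA.
split; rewrite /derivable /derive e //.
exact: diff_derivable.
Qed.

(** The mean value theorem, for [f] along the segment minus the quadratic bound, replaces
    integration of the gradient: the derivative of this difference is nonpositive on [(0, 1)]. *)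
Lemma descent_lemma f (ell : R) : 0 < ell ->
  (forall y, differentiable f y) ->
  (forall x y, mxdot (grad f x - grad f y) (grad f x - grad f y)
     <= ell ^+ 2 * mxdot (x - y) (x - y)) ->
  forall x v, f (x + v) <= f x + mxdot (grad f x) v + ell / 2 * mxdot v v.
Proof.
move=> l0 df lip x v.
pose a := mxdot (grad f x) v; pose b := mxdot v v.
pose g (t : R) := f (x + t *: v) - (a * t + ell / 2 * b * t ^+ 2).
pose dg (t : R) := mxdot (grad f (x + t *: v)) v - (a + ell * b * t).
have gd (t : R) : is_derive t 1 g (dg t).
  apply: is_deriveB; first exact: is_derive_line.
  have h1 : is_derive t 1 (fun s : R => a * s) a.
    by apply: is_derive_eq; rewrite /GRing.scale /= mulr1.
  have h2 : is_derive t 1 (fun s : R => ell / 2 * b * s ^+ 2) (ell * b * t).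
    apply: is_derive_eq; rewrite /GRing.scale /= !mulr1.
    by field.
  exact: is_deriveD.
have [|c c01 e] := @MVT R g dg 0 1 ltr01 (fun t _ => gd t).
  apply: continuous_subspaceT => t; apply: differentiable_continuous.
  by apply/derivable1_diffP; case: (gd t).
move: c01; rewrite in_itv /= => /andP[c0 c1].
have {}c1 := ltW c1.
suff : dg c <= 0.
  rewrite -[dg c]mulr1 -[X in _ * X](subr0 1) -e /g /a /b !scale1r scale0r addr0.
  by rewrite expr0n /= expr1n !mulr0 !mulr1; lra.
have := lip (x + c *: v) x; rewrite addrAC subrr add0r mxdotZl mxdotZr -/b => h.
rewrite /dg /a subr_le0 -lerBlDl -mxdotNl -mxdotDl.
(* This weight balances the two halves, so Young gives exactly [ell c |v|^2]. *)
have q : 0 < (ell * c)^-1 by rewrite invr_gt0 mulr_gt0.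
have /andP[_ /le_trans] := mxdot_young (grad f (x + c *: v) - grad f x) v q.
apply; rewrite -/b.
have -> : (2 * (ell * c)^-1)^-1 = ell * c / 2 by field; rewrite !gt_eqF.
have := ler_wpM2l (ltW q) h.
have -> : (ell * c)^-1 * (ell ^+ 2 * (c * (c * b))) = ell * b * c.
  by field; rewrite !gt_eqF.
by lra.
Qed.

Lemma grad_lipschitz_sqr f (ell : R) :
  (forall x y, enorm (grad f x - grad f y) <= ell * enorm (x - y)) ->
  forall x y, mxdot (grad f x - grad f y) (grad f x - grad f y)
     <= ell ^+ 2 * mxdot (x - y) (x - y).
Proof.
move=> lip x y; rewrite -!enorm_sqr -exprMn.
by rewrite lerXn2r ?nnegrE ?enorm_ge0 // (le_trans (enorm_ge0 _) (lip x y)).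
Qed.

(** Induction with Young weight [1 / n]: the old bound [n] is multiplied by [1 + 1 / n] and the new
    vector by [1 + n], both giving [n + 1]. *)
Lemma mxdot_sum_le n (u : 'I_n -> 'rV[R]_d) :
  mxdot (\sum_i u i) (\sum_i u i) <= n%:R * \sum_i mxdot (u i) (u i).
Proof.
elim: n u => [|n IH] u; first by rewrite !big_ord0 mul0r mxdot0l.
rewrite !big_ord_recr /=.
set s := \sum_(i < n) _; set t := u ord_max; set q := \sum_(i < n) _.
have hs : mxdot s s <= n%:R * q := IH (fun i => u (widen_ord (leqnSn n) i)).
case: n => [|n] in IH u s t q hs *.
  rewrite /s /q !big_ord0 !add0r mul1r //.
have n0 : 0 < n.+1%:R :> R by rewrite ltr0n.
have := mxdot_add_le s t (_ : 0 < n.+1%:R^-1); rewrite invr_gt0 => /(_ n0).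
rewrite invrK => /le_trans; apply.
rewrite -[n.+2]addn1 natrD.
have : n.+1%:R^-1 * mxdot s s <= q by rewrite mulrC ler_pdivrMr // mulrC.
by move: hs; move: (n.+1%:R : R) (n.+1%:R^-1) (mxdot s s) (mxdot t t) => N V a b; lra.
Qed.

Lemma average_sqr_le n (u : 'I_n -> 'rV[R]_d) : (0 < n)%N ->
  n%:R * mxdot (average u) (average u) <= \sum_i mxdot (u i) (u i).
Proof.
move=> n0; have n0' : 0 < n%:R :> R by rewrite ltr0n.
rewrite /average mxdotZl mxdotZr mulrA divff ?gt_eqF // mul1r.
by rewrite mulrC ler_pdivrMr // mulrC; exact: mxdot_sum_le.
Qed.

Lemma differentiable_average_cost n (f : 'I_n -> 'rV[R]_d -> R) x :
  (forall i, differentiable (f i) x) -> differentiable (average_cost f) x.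
Proof.
move=> df; rewrite (_ : average_cost f = n%:R^-1 *: \sum_(i < n) f i); last first.
  by apply/funext => y; rewrite /average_cost fctE fct_sumE.
by apply: differentiableZ; apply: differentiable_sum.
Qed.

Lemma grad_average_cost n (f : 'I_n -> 'rV[R]_d -> R) x :
  (forall i, differentiable (f i) x) ->
  grad (average_cost f) x = average (fun i => grad (f i) x).
Proof.
move=> df; rewrite (_ : average_cost f = n%:R^-1 *: \sum_(i < n) f i); last first.
  by apply/funext => y; rewrite /average_cost fctE fct_sumE.
apply/rowP => j; rewrite !mxE deriveZ; last first.
  by apply: derivable_sum => i; exact: diff_derivable.
rewrite derive_sum => [|i]; last exact: diff_derivable.
by congr (_ *: _); rewrite summxE; apply: eq_bigr => i _; rewrite mxE.
Qed.

End Smooth.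

(** * Measurability and independence *)

Section BorelRV.
Variables (R : realType) (d : nat).

Lemma continuous_measurable_rV (g : 'rV[R]_d -> R) :
  continuous g -> measurable_fun [set: borel_rV R d] (g : borel_rV R d -> R).
Proof.
move=> /continuousP cg; apply: (measurability _ (RGenOInfty.measurableE R)).
move=> _ [_ [a ->] <-]; rewrite setTI.
by apply: sub_sigma_algebra; apply: cg; exact: interval_open.
Qed.

Lemma measurable_coord_rV j :
  measurable_fun [set: borel_rV R d] (fun v : borel_rV R d => (v : 'rV[R]_d) 0 j).
Proof. by apply: continuous_measurable_rV; exact: coord_continuous. Qed.

Let cell (p : 'rV[rat]_d * nat) : set 'rV[R]_d :=
  [set v | forall j, `|v 0 j - ratr (p.1 0 j)| < p.2.+1%:R^-1].

(** Cells are sup-norm cubes with rational centres and radii [1 / (m + 1)], hence countably many.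
    The radius is taken below [e / 2] so that two legs of the triangle inequality fit in the
    ball. *)
Let rat_cell_cover (U : set 'rV[R]_d) : open U ->
  U = \bigcup_(p in [set p | cell p `<=` U]) cell p.
Proof.
move=> oU; apply/seteqP; split => [v Uv|v [p /= sub /sub //]].
have : nbhs v U by rewrite nbhsE; exists U.
move=> /nbhs_ballP[e /= e0 eU].
have [m me] : exists m : nat, m.+1%:R^-1 < e / 2.
  have e2 : 0 < (e / 2)^-1 by rewrite invr_gt0 divr_gt0.
  exists (Num.bound (e / 2)^-1).
  rewrite -[ltRHS]invrK ltf_pV2 ?posrE ?ltr0n //.
  by apply: lt_trans (archi_boundP (ltW e2)) _; rewrite ltr_nat.
have q j : exists q : rat, `|v 0 j - ratr q| < m.+1%:R^-1.
  have /rat_in_itvoo[q] : v 0 j - m.+1%:R^-1 < v 0 j + m.+1%:R^-1.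
    by rewrite ltrBlDr -addrA ltrDl addr_gt0 // invr_gt0 ltr0n.
  rewrite in_itv /= => /andP[h1 h2]; exists q.
  by rewrite distrC ltr_distl h1 h2.
have [c cP] := choice q.
exists (\row_j c j, m) => /=.
  move=> y cy; apply: eU; split=> // i j; rewrite (ord1 i) /ball /=.
  have := cy j; have := cP j; rewrite /= mxE => h1 h2.
  rewrite -(subrK (ratr (c j)) (v 0 j)) -addrA.
  apply: le_lt_trans (ler_normD _ _) _; rewrite (distrC (ratr _)).
  by rewrite (splitr e) ltrD //; apply: lt_trans me.
by move=> j; rewrite /= mxE.
Qed.

(* An open set is a countable union of rational cells. *)
Lemma measurable_rV (dT : measure_display) (T : measurableType dT)
    (g : T -> 'rV[R]_d) :
  (forall j, measurable_fun [set: T] (fun w => g w 0 j)) ->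
  measurable_fun [set: T] (g : T -> borel_rV R d).
Proof.
move=> mg; apply: (@measurability _ _ T (borel_rV R d) _ _ [set U : set 'rV[R]_d | open U]) => //.
move=> _ [U oU <-]; rewrite setTI (rat_cell_cover oU) preimage_bigcup bigcup_mkcond.
apply: countable_bigcupT_measurable => [|p]; first exact: countableP.
case: ifP => // _.
rewrite (_ : g @^-1` cell p = \bigcap_(j in [set: 'I_d])
  (fun w => g w 0 j) @^-1` [set x | `|x - ratr (p.1 0 j)| < p.2.+1%:R^-1]).
  apply: fin_bigcap_measurable => // j _; rewrite -[X in measurable X]setTI.
  apply: mg => //.
  rewrite (_ : [set x | _] = `]ratr (p.1 0 j) - p.2.+1%:R^-1,
    ratr (p.1 0 j) + p.2.+1%:R^-1[%classic) //.
  by apply/seteqP; split => x /=; rewrite in_itv /= ltr_distl.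
by apply/seteqP; split => w /= h j; [move=> _|]; exact: h.
Qed.

End BorelRV.

(** * Independence of one seed from the sigma-algebra of other seeds *)

Section Independence.
Variables (R : realType) (I : choiceType) (dO : measure_display)
  (Omega : measurableType dO) (P : probability Omega R)
  (dZ : measure_display) (Z : measurableType dZ) (mu : probability Z R)
  (X : I -> Omega -> Z).
Hypothesis hX : iid_with_law P mu X.

(** A pi-system generating the sigma-algebra of the seeds indexed by [J]. *)
Definition cylinders (J : pred I) : set (set Omega) :=
  [set E | exists s : seq I, exists B : I -> set Z,
     [/\ uniq s, {subset s <= J}, forall j, measurable (B j)
       & E = \bigcap_(j in [set` s]) (X j @^-1` B j)]].

Lemma measurable_seed_preimage i (B : set Z) :
  measurable B -> measurable (X i @^-1` B).
Proof. by case: hX => mX _ _ mB; rewrite -[X in measurable X]setTI; exact: mX. Qed.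

Lemma cylinders_measurable J E : cylinders J E -> measurable E.
Proof.
move=> [s [B [us _ mB ->]]]; apply: fin_bigcap_measurable => //.
by move=> j _; exact: measurable_seed_preimage.
Qed.

Lemma cylinders_setI J : setI_closed (cylinders J).
Proof.
move=> _ _ [s [B [us sJ mB ->]]] [s' [B' [us' s'J mB' ->]]].
exists (undup (s ++ s')), (fun j => (if j \in s then B j else setT) `&`
  (if j \in s' then B' j else setT)); split.
- exact: undup_uniq.
- by move=> j; rewrite mem_undup mem_cat => /orP[/sJ|/s'J].
- by move=> j; apply: measurableI; case: ifP.
apply/seteqP; split => [w [/= h h'] j /=|w /= h].
  rewrite mem_undup mem_cat => _; split; case: ifP => //.
    by move=> js; exact: h.
  by move=> js; exact: h'.
split => j /= js.
  by have [] := h j; [rewrite /= mem_undup mem_cat js|rewrite js].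
by have [] := h j; [rewrite /= mem_undup mem_cat js orbT|rewrite js].
Qed.

(** Dynkin's argument on [E]: cylinders by the product formula for the list [i :: s], then
    complements and disjoint unions. Measurability of [E] in [Omega] travels along because these
    last two cases use it. *)
Lemma seed_indep_cylinders J i (E : set Omega) (B : set Z) :
  i \notin J -> <<s cylinders J >> E -> measurable B ->
  measurable E /\ P (X i @^-1` B `&` E) = (mu B * P E)%E.
Proof.
move=> iJ hE mB; have mXB := measurable_seed_preimage i mB.
have muB : P (X i @^-1` B) = mu B by case: hX => _ + _; apply.
move: E hE; apply: (@dynkin_induction _
    (g_sigma_algebraType (cylinders J)) (cylinders J)) => //.
- exact: cylinders_setI.
- by split=> //; rewrite setIT probability_setT mule1.
- move=> E EJ; split; first exact: cylinders_measurable EJ.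
  case: EJ => s [B' [us sJ mB' ->]].
  have is' : i \notin s by apply: contra iJ; exact: sJ.
  pose B'' j := if j == i then B else B' j.
  have [_ _ ind] := hX.
  have -> : X i @^-1` B `&` \bigcap_(j in [set` s]) X j @^-1` B' j =
      \bigcap_(j in [set` i :: s]) X j @^-1` B'' j.
    apply/seteqP; split => [w [/= h h'] j /=|w /= h].
      rewrite inE /B''; case: eqVneq => [->//|_ /= js]; exact: h'.
    split; first by have := h i; rewrite /= inE eqxx /B'' eqxx; exact.
    move=> j /= js; have := h j; rewrite /= inE js orbT /B''.
    by case: eqVneq => [e|_]; [move: is'; rewrite -e js|exact].
  rewrite ind; last 2 first.
  - by rewrite /= is'.
  - by move=> j; rewrite /B''; case: ifP.
  rewrite big_cons {1}/B'' eqxx muB ind //; congr (_ * _)%E.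
  apply: eq_big_seq => j js; rewrite /B''; case: eqVneq => // e.
  by move: is'; rewrite -e js.
- move=> S _ [mS eS]; split; first exact: measurableC.
  rewrite -setDE; transitivity (mu B - mu B * P S)%E.
    rewrite measureD //; last by rewrite ltey_eq fin_num_measure.
    by congr (_ - _)%E.
  rewrite probability_setC // muleBr ?mule1 ?fin_num_measure //.
- move=> F _ tF hF; have mF n : measurable (F n : set Omega) by case: (hF n).
  split; first exact: bigcupT_measurable.
  rewrite setI_bigcupr measure_semi_bigcup; last 3 first.
  - by move=> n; exact: measurableI.
  - exact: trivIset_setIl.
  - by apply: bigcupT_measurable => n; exact: measurableI.
  rewrite measure_semi_bigcup //; last exact: bigcupT_measurable.
  rewrite -[mu B]fineK ?fin_num_measure // -nneseriesZl //.
  apply: eq_eseriesr => n _; rewrite fineK ?fin_num_measure //.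
  by case: (hF n).
Qed.

Lemma measurable_fun_cylinders J d2 (T2 : measurableType d2) (Y : Omega -> T2) :
  measurable_fun setT (Y : g_sigma_algebraType (cylinders J) -> T2) ->
  measurable_fun setT Y.
Proof.
move=> mY _ B mB; have := mY measurableT B mB; rewrite !setTI.
apply: smallest_sub; first exact: sigma_algebra_measurable.
by move=> E; exact: cylinders_measurable.
Qed.

(* Tonelli for the joint law of [X i] and [Y], which is a product measure. *)
Lemma seed_integral J i d2 (T2 : measurableType d2) (Y : Omega -> T2)
    (h : Z * T2 -> \bar R) : i \notin J ->
  measurable_fun setT (Y : g_sigma_algebraType (cylinders J) -> T2) ->
  measurable_fun [set: Z * T2] h -> (forall p, 0 <= h p)%E ->
  (\int[P]_w h (X i w, Y w) = \int[P]_w \int[mu]_z h (z, Y w))%E.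
Proof.
move=> iJ mY mh h0; have mY' := measurable_fun_cylinders mY.
have mXi : measurable_fun setT (X i) by case: hX.
have mf : measurable_fun setT (fun w => (X i w, Y w)).
  exact: measurable_fun_pair.
pose f : {mfun Omega >-> (Z * T2)%type} := mfun_Sub (mem_set mf).
pose Ym : {mfun Omega >-> T2} := mfun_Sub (mem_set mY').
have -> : (\int[P]_w h (X i w, Y w) = \int[distribution P f]_p h p)%E.
  by rewrite ge0_integral_distribution.
rewrite (@eq_measure_integral _ _ _ setT (mu \x distribution P Ym)%E); last first.
  move=> E mE _; apply/esym.
  apply: (@product_measure_unique _ _ _ _ _ mu (distribution P Ym)) => //.
  move=> A B mA mB; rewrite /distribution /pushforward.
  have [] := seed_indep_cylinders iJ (_ : <<s cylinders J >> (Y @^-1` B)) mA.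
    by have := mY measurableT B mB; rewrite setTI.
  by [].
rewrite fubini_tonelli2 // ge0_integral_distribution //.
- exact: measurable_fun_fubini_tonelli_G.
- by move=> y; apply: integral_ge0.
Qed.

End Independence.

(** * One iteration of the algorithm *)

Lemma mxdot_convex (R : realFieldType) n d (t : R) (X Y : 'M[R]_(n, d)) :
  0 <= t <= 1 ->
  mxdot ((1 - t) *: X + t *: Y) ((1 - t) *: X + t *: Y)
    <= (1 - t) * mxdot X X + t * mxdot Y Y.
Proof.
case/andP=> t0 t1; have := mxdot_ge0 (X - Y).
rewrite !mxdot_lin (mxdotC Y X) => h.
have h2 : 0 <= t * (1 - t) by rewrite mulr_ge0 // subr_ge0.
by have := mulr_ge0 h2 h; lra.
Qed.

Lemma mxdot_rows (R : realFieldType) n d (X Y : 'M[R]_(n, d)) :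
  mxdot X Y = \sum_i mxdot (row i X) (row i Y).
Proof.
rewrite mxdotE; apply: eq_bigr => i _; rewrite mxdotE big_ord1.
by apply: eq_bigr => j _; rewrite !mxE.
Qed.

Section OneStep.
Variables (R : realType) (n d : nat) (A : 'M[R]_n).
Hypotheses (n_ge2 : (2 <= n)%N) (hA : is_adjacency A)
  (hconn : graph_connected A).
Variables (f : 'I_n -> 'rV[R]_d -> R) (Lf fstar nu : R).
Hypotheses (Lf_gt0 : 0 < Lf)
  (hdiff : forall i x, differentiable (f i) x)
  (hLip : forall i x y,
     enorm (grad (f i) x - grad (f i) y) <= Lf * enorm (x - y))
  (hmin : is_minimum (average_cost f) fstar) (nu_gt0 : 0 < nu)
  (hPL : polyak_lojasiewicz (average_cost f) fstar nu).
Variables (phi r beta eta psi kappa1 kappa4 : R).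
Local Notation alpha := (kappa1 * beta).
Local Notation L := (laplacian A).
Local Notation J := (avg_mx R n).
Local Notation K := (1%:M - J).
Local Notation rho := (spectral_radius L).
Local Notation rho2 := (min_pos_eigenvalue L).
Local Notation s := (phi * psi * r).
Hypotheses (phi01 : 0 < phi <= 1) (r_gt0 : 0 < r) (psi01 : 0 < psi <= r^-1)
  (kappa4_gt0 : 0 < kappa4)
  (hkappa1 : Num.max ((9 + kappa4) / (2 * rho2)) 1 <= kappa1)
  (hbeta : kappa2 rho2 Lf kappa1 kappa4 < beta)
  (heta : 0 < eta < kappa3 rho rho2 Lf phi r alpha beta psi).
Variable Q : 'M[R]_n.
Hypotheses (LQ : L *m Q = K) (JQ : J *m Q = 0).

Definition mean_row (X : 'M[R]_(n, d)) : 'rV[R]_d := average (fun i => row i X).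
Definition grads (X : 'M[R]_(n, d)) : 'M[R]_(n, d) :=
  \matrix_(i < n) grad (f i) (row i X).
Definition mean_grads (X : 'M[R]_(n, d)) : 'M[R]_(n, d) :=
  \matrix_(i < n) grad (f i) (mean_row X).

Lemma row_avg (X : 'M[R]_(n, d)) i : row i (J *m X) = mean_row X.
Proof.
apply/rowP => j; rewrite [LHS]mxE avg_mx_mulE !mxE summxE.
by congr (_ * _); apply: eq_bigr => k _; rewrite mxE.
Qed.

Lemma mxdot_avg (X : 'M[R]_(n, d)) :
  mxdot (J *m X) (J *m X) = n%:R * mxdot (mean_row X) (mean_row X).
Proof.
rewrite mxdot_rows; under eq_bigr do rewrite row_avg.
by rewrite sumr_const card_ord mulr_natl.
Qed.

Lemma avg_ctr : J *m K = 0.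
Proof. by rewrite mulmxBr mulmx1 avg_mx_id // subrr. Qed.

Lemma ctr_sym : K^T = K.
Proof. by rewrite linearB /= trmx1 avg_mx_sym. Qed.

(** [Q^T = Q^T K = (Q^T L) Q = K Q = Q]. *)
Lemma pinv_sym : Q^T = Q.
Proof.
have h1 : Q^T *m L = K.
  by rewrite -(laplacian_sym hA) -trmx_mul LQ ctr_sym.
have h2 : Q^T *m J = 0 by rewrite -avg_mx_sym -trmx_mul JQ trmx0.
have : Q^T *m K = Q^T by rewrite mulmxBr mulmx1 h2 subr0.
by rewrite -LQ mulmxA h1 mulmxBl mul1mx JQ subr0.
Qed.

Lemma pinv_laplacian : Q *m L = K.
Proof. by rewrite -[LHS]trmxK trmx_mul pinv_sym laplacian_sym // LQ ctr_sym. Qed.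

Lemma mxdot_pythagoras (X : 'M[R]_(n, d)) :
  mxdot X X = mxdot (K *m X) (K *m X) + mxdot (J *m X) (J *m X).
Proof.
have e : X = K *m X + J *m X by rewrite -mulmxDl subrK mul1mx.
rewrite {1 2}e mxdotDl !mxdotDr.
rewrite (mxdot_mull J X (K *m X)) avg_mx_sym mulmxA avg_ctr mul0mx.
rewrite (mxdotC (K *m X) (J *m X)) (mxdot_mull J X (K *m X)).
by rewrite avg_mx_sym mulmxA avg_ctr mul0mx !(mxdotC X) mxdot0l addr0 add0r.
Qed.

Lemma mxdot_ctr_le (X : 'M[R]_(n, d)) :
  mxdot (K *m X) (K *m X) <= mxdot X X.
Proof. by rewrite [leRHS]mxdot_pythagoras lerDl mxdot_ge0. Qed.

Lemma grad_sqr_le i x y :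
  mxdot (grad (f i) x - grad (f i) y) (grad (f i) x - grad (f i) y)
    <= Lf ^+ 2 * mxdot (x - y) (x - y).
Proof. exact: grad_lipschitz_sqr (hLip i) x y. Qed.

Lemma grads_dev_le (X : 'M[R]_(n, d)) :
  mxdot (grads X - mean_grads X) (grads X - mean_grads X)
    <= Lf ^+ 2 * mxdot (K *m X) (K *m X).
Proof.
rewrite (mxdot_rows (grads X - _)) (mxdot_rows (K *m X)) mulr_sumr; apply: ler_sum => i _.
rewrite linearB /= !rowK mulmxBl mul1mx linearB /= row_avg.
exact: grad_sqr_le.
Qed.

Lemma mean_grads_le (X Y : 'M[R]_(n, d)) :
  mxdot (mean_grads X - mean_grads Y) (mean_grads X - mean_grads Y)
    <= Lf ^+ 2 * (n%:R * mxdot (mean_row X - mean_row Y) (mean_row X - mean_row Y)).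
Proof.
rewrite mxdot_rows.
have -> : Lf ^+ 2 * (n%:R * mxdot (mean_row X - mean_row Y) (mean_row X - mean_row Y))
  = \sum_(i < n) Lf ^+ 2 * mxdot (mean_row X - mean_row Y) (mean_row X - mean_row Y).
  by rewrite sumr_const card_ord -[RHS]mulr_natl mulrCA.
by apply: ler_sum => i _; rewrite linearB /= !rowK; exact: grad_sqr_le.
Qed.

Local Notation F := (average_cost f).

Lemma grad_F x : grad F x = average (fun i => grad (f i) x).
Proof. by apply: grad_average_cost => i. Qed.

Lemma grad_F_mean X : grad F (mean_row X) = mean_row (mean_grads X).
Proof.
rewrite grad_F /mean_row; congr average; apply/funext => i.
by rewrite rowK.
Qed.

Lemma average_diff_le (u v : 'I_n -> 'rV[R]_d) :
  n%:R * mxdot (average u - average v) (average u - average v)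
    <= \sum_i mxdot (u i - v i) (u i - v i).
Proof.
have -> : average u - average v = average (fun i => u i - v i).
  by rewrite /average -scalerBr sumrB.
by apply: average_sqr_le; exact: leq_trans n_ge2.
Qed.

Lemma F_lipschitz x y :
  mxdot (grad F x - grad F y) (grad F x - grad F y)
     <= Lf ^+ 2 * mxdot (x - y) (x - y).
Proof.
have n0 : 0 < n%:R :> R by rewrite ltr0n (leq_trans _ n_ge2).
rewrite -(ler_pM2l n0) !grad_F; apply: (le_trans (average_diff_le _ _)).
apply: (@le_trans _ _ (\sum_(i < n) Lf ^+ 2 * mxdot (x - y) (x - y))).
  by apply: ler_sum => i _; exact: grad_sqr_le.
by rewrite sumr_const card_ord mulr_natl.
Qed.

Lemma F_descent x v : F (x + v) <= F x + mxdot (grad F x) v + Lf / 2 * mxdot v v.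
Proof.
apply: descent_lemma => //; last exact: F_lipschitz.
by move=> y; apply: differentiable_average_cost.
Qed.

Definition opt_gap (X : 'M[R]_(n, d)) : R := n%:R * (F (mean_row X) - fstar).

Lemma opt_gap_ge0 X : 0 <= opt_gap X.
Proof. by case: hmin => _ h; rewrite mulr_ge0 // subr_ge0. Qed.

(** Descent along [- eta g], with [- <grad F, g>] polarised into [(|g - grad F|^2 - |g|^2 - |grad
    F|^2) / 2]. The first square is bounded by the disagreement of the agents, the second pays for
    the drift of [z], and the Polyak-Lojasiewicz condition acts on the third. *)
Lemma opt_gap_step (X X' : 'M[R]_(n, d)) : 0 < eta ->
  mean_row X' = mean_row X - eta *: mean_row (grads X) ->
  opt_gap X' <= opt_gap X - eta / 2 * mxdot (J *m grads X) (J *m grads X)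
    - eta * nu * opt_gap X + eta / 2 * (Lf ^+ 2 * mxdot (K *m X) (K *m X))
    + eta ^+ 2 * (Lf / 2) * mxdot (J *m grads X) (J *m grads X).
Proof.
move=> n0 e; rewrite mxdot_avg /opt_gap.
set g := mean_row (grads X) in e *; set x := mean_row X in e *.
have := F_descent x (- (eta *: g)); rewrite -e mxdotNr mxdotNl mxdotNr opprK.
rewrite !(mxdotZr eta) (mxdotZl eta) => h1.
have h2 : 2 * nu * (F x - fstar) <= mxdot (grad F x) (grad F x).
  by have := hPL x; rewrite enorm_sqr; lra.
have h3 : n%:R * mxdot (g - grad F x) (g - grad F x)
    <= Lf ^+ 2 * mxdot (K *m X) (K *m X).
  rewrite grad_F_mean; apply: le_trans (grads_dev_le X).
  rewrite (mxdot_rows (grads X - _)); apply: le_trans (average_diff_le _ _) _.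
  by apply: ler_sum => i _; rewrite linearB.
move: h3; rewrite mxdotDl !mxdotDr !mxdotNl !mxdotNr opprK (mxdotC g (grad F x)).
set c := mxdot (grad F x) g in h1 *; set b := mxdot (grad F x) _ in h2 *.
set a := mxdot g g in h1 *; move=> h3.
have nn : 0 <= n%:R :> R by [].
have k1 := ler_wpM2l nn h1.
have k2 := ler_wpM2l (mulr_ge0 (ltW n0) nn) h2.
have k3 := ler_wpM2l (ltW n0) h3.
by lra.
Qed.

(** At a consensus equilibrium [beta v_i = - grad f_i], so this vanishes there. With [Q] in front,
    [L *m z] is the centred deviation of [V], which is what the primal update contains. *)
Definition dual_var (X V : 'M[R]_(n, d)) : 'M[R]_(n, d) :=
  Q *m (V + beta^-1 *: mean_grads X).

Definition lyap (X Aa V : 'M[R]_(n, d)) : R :=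
  pd_lyap kappa1 L (K *m X) (dual_var X V) + opt_gap X + mxdot (X - Aa) (X - Aa).

Let hgap := let: And3 _ _ h := min_pos_eigenvalueP n_ge2 hA hconn in h.
Lemma rho2_gt0 : 0 < rho2. Proof. by case: (min_pos_eigenvalueP n_ge2 hA hconn). Qed.
Let rho2_le : rho2 <= rho := min_pos_eigenvalue_le_radius n_ge2 hA hconn.

(** Young with weight [1 / (kappa1 rho2)], then the spectral gap on [z]: the share [kappa1 / 2] of
    [<z, L z>] stays below the [(kappa1 + 1) / 2] in [pd_lyap]. *)
Lemma pd_lyap_cross (x z : 'M[R]_(n, d)) : J *m z = 0 ->
  - ((2 * (kappa1 * rho2))^-1 * mxdot x x + kappa1 / 2 * mxdot z (L *m z))
    <= mxdot x z
    <= (2 * (kappa1 * rho2))^-1 * mxdot x x + kappa1 / 2 * mxdot z (L *m z).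
Proof.
move=> Jz; have p2 := rho2_gt0.
have k0 : 0 < kappa1 := lt_le_trans ltr01 (kappa1_ge1 hkappa1).
have q : 0 < (kappa1 * rho2)^-1 by rewrite invr_gt0 mulr_gt0.
have := mxdot_young x z q.
have -> : (kappa1 * rho2)^-1 / 2 = (2 * (kappa1 * rho2))^-1.
  by field; rewrite !gt_eqF.
have -> : (2 * (kappa1 * rho2)^-1)^-1 = kappa1 / 2 * rho2.
  by field; rewrite !gt_eqF.
have kk : 0 <= kappa1 / 2 by rewrite divr_ge0 // ltW.
have := ler_wpM2l kk (hgap Jz); rewrite mulrA => h /andP[h1 h2].
by apply/andP; split; lra.
Qed.

(** The cross term raises the weights to [1/2 + 1 / (2 kappa1 rho2)] on [|x|^2] and [kappa1 + 1/2]
    on [<z, L z>]: the two entries of [eps11]. *)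
Lemma lyap_upper (x z : 'M[R]_(n, d)) (W D : R) : J *m z = 0 -> 0 <= W -> 0 <= D ->
  pd_lyap kappa1 L x z + W + D <=
  eps11 rho2 alpha beta * (mxdot x x + mxdot z (L *m z) + W + D).
Proof.
move=> Jz W0 D0; have /andP[_ h] := pd_lyap_cross x Jz.
have p2 := rho2_gt0.
have k0 : 0 < kappa1 := lt_le_trans ltr01 (kappa1_ge1 hkappa1).
have b0 := beta_gt0 p2 hbeta.
have h1 : 2^-1 + (2 * (kappa1 * rho2))^-1 <= eps11 rho2 alpha beta.
  rewrite /eps11 le_max; apply/orP; right.
  by rewrite le_eqVlt; apply/orP; left; apply/eqP; field; rewrite !gt_eqF.
have h2 : kappa1 + 2^-1 <= eps11 rho2 alpha beta.
  by rewrite /eps11 le_max mulfK ?gt_eqF // addrC lexx.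
have k1 := kappa1_ge1 hkappa1.
have h3 : 1 <= eps11 rho2 alpha beta by lra.
have := ler_wpM2r (mxdot_ge0 x) h1.
have := ler_wpM2r (laplacian_psd hA z) h2.
have := ler_wpM2r W0 h3; have := ler_wpM2r D0 h3.
rewrite /pd_lyap; move: h; set m := (2 * _)^-1; lra.
Qed.

(** As [kappa1 rho2 >= 9/2], the cross term takes at most [1/9] from the weight [1/2] of [|K x|^2],
    leaving [7/18 >= 1/3]. *)
Lemma lyap_lower (X Aa V : 'M[R]_(n, d)) :
  mxdot (K *m X) (K *m X) + opt_gap X + mxdot (X - Aa) (X - Aa)
    <= 3 * lyap X Aa V.
Proof.
have Jz : J *m dual_var X V = 0 by rewrite /dual_var mulmxA JQ mul0mx.
have /andP[h _] := pd_lyap_cross (K *m X) Jz.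
have p2 := rho2_gt0.
have k0 : 0 < kappa1 := lt_le_trans ltr01 (kappa1_ge1 hkappa1).
have kr : (2 * (kappa1 * rho2))^-1 <= 9^-1.
  rewrite lef_pV2 ?posrE ?mulr_gt0 //.
  by have k4 := kappa4_gt0; have := kappa1_rho2 p2 hkappa1; lra.
have := ler_wpM2r (mxdot_ge0 (K *m X)) kr.
have := laplacian_psd hA (dual_var X V); have := opt_gap_ge0 X.
have := mxdot_ge0 (X - Aa); have := mxdot_ge0 (K *m X).
rewrite /lyap /pd_lyap; move: h; set m := (2 * _)^-1; lra.
Qed.

(* The inequality holds for every outcome [q] of the compressor: averaging it
   only requires the compressor bound on the last term. *)
Lemma lyap_step (X Aa V q U X' Aa' V' : 'M[R]_(n, d)) : J *m V = 0 ->
  U = Aa + q ->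
  X' = X - (eta * alpha) *: (L *m U) - eta *: (beta *: V + grads X) ->
  Aa' = Aa + psi *: q ->
  V' = V + (eta * beta) *: (L *m U) ->
  lyap X' Aa' V'
    + gap_coef rho phi r beta eta psi kappa1
      * ((1 - phi) * mxdot (X - Aa) (X - Aa))
  <= (1 - epsilon rho rho2 Lf nu phi r alpha beta eta psi) * lyap X Aa V
    + gap_coef rho phi r beta eta psi kappa1
      * mxdot (r^-1 *: q - (X - Aa)) (r^-1 *: q - (X - Aa)).
Proof.
move=> JV hU hX hAa hV.
have p2 := rho2_gt0; have n0 := eta_gt0 heta.
have b0 := beta_gt0 p2 hbeta.
have k1 := kappa1_ge1 hkappa1.
have LK : L *m K = L by rewrite mulmxBr mulmx1 laplacian_avg subr0.
have KL : K *m L = L by rewrite mulmxBl mul1mx avg_laplacian // subr0.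
have KV : K *m V = V by rewrite mulmxBl mul1mx JV subr0.
have JLU : J *m (L *m U) = 0 by rewrite mulmxA avg_laplacian // mul0mx.
pose x := K *m X; pose z := dual_var X V.
pose e := K *m (q - (X - Aa)); pose g := K *m (grads X - mean_grads X).
(* The drift of [z] caused by moving the average at which its gradients are taken. *)
pose delta := Q *m (beta^-1 *: (mean_grads X' - mean_grads X)).
have xe : x + e = K *m U.
  by rewrite hU /x /e -mulmxDr opprB addrCA (addrC X) subrK addrC.
have Jx : J *m x = 0 by rewrite /x mulmxA avg_ctr mul0mx.
have Jz : J *m z = 0 by rewrite /z /dual_var mulmxA JQ mul0mx.
have Jd : J *m delta = 0 by rewrite /delta mulmxA JQ mul0mx.
pose p := (kappa1 * beta) *: (L *m (x + e)) + beta *: (L *m z) + g.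
(* [L *m Q = K] turns [beta L z] into [beta V] plus the centred mean gradients, which cancel against
   those in [g]. *)
have pE : p = (kappa1 * beta) *: (L *m U) + beta *: V + K *m grads X.
  rewrite /p xe mulmxA LK /z /dual_var mulmxA LQ mulmxDr KV -scalemxAr.
  rewrite scalerDr scalerA divff ?gt_eqF // scale1r /g mulmxBr.
  by rewrite -addrA -[in LHS]addrA (addrCA _ (K *m grads X)) subrr addr0 addrA.
have KX' : K *m X' = x - eta *: p.
  rewrite hX !mulmxBr -!scalemxAr mulmxA KL mulmxDr -scalemxAr KV pE.
  by rewrite !scalerDr !scalerA !opprD !addrA.
have JX' : J *m X' = J *m X - eta *: (J *m grads X).
  rewrite hX !mulmxBr -!scalemxAr JLU scaler0 subr0 mulmxDr -scalemxAr JV.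
  by rewrite scaler0 add0r.
have mX' : mean_row X' = mean_row X - eta *: mean_row (grads X).
  pose i0 : 'I_n := Ordinal n_ge2.
  by rewrite -!(row_avg _ i0) JX' linearB /= linearZ.
have z' : dual_var X' V' = z + (eta * beta) *: (x + e) + delta.
  rewrite xe /dual_var hV /z /dual_var /delta !mulmxDr -!scalemxAr mulmxBr.
  rewrite scalerBr !mulmxA pinv_laplacian -!addrA; congr (_ + _).
  by rewrite addrCA; congr (_ + _); rewrite addrC subrK.
have dX : X' - X = - eta *: ((kappa1 * beta) *: (L *m U) + beta *: V + grads X).
  rewrite hX scaleNr !scalerDr !scalerA !opprD addrC !addrA addNr add0r.
  by [].
pose H := mxdot (J *m grads X) (J *m grads X).
have gle : mxdot g g <= Lf ^+ 2 * mxdot x x.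
  exact: le_trans (mxdot_ctr_le _) (grads_dev_le X).
have dle : mxdot (L *m delta) (L *m delta)
    <= eta ^+ 2 * (Lf ^+ 2 / beta ^+ 2 * H).
  rewrite /delta mulmxA LQ -scalemxAr mxdotZl mxdotZr mulrA -expr2.
  apply: (@le_trans _ _ (beta^-1 ^+ 2 * (Lf ^+ 2 * (eta ^+ 2 * H)))); last first.
    by rewrite exprVn le_eqVlt; apply/orP; left; apply/eqP; ring.
  apply: ler_wpM2l; first exact: sqr_ge0.
  apply: le_trans (mxdot_ctr_le _) _.
  apply: (le_trans (mean_grads_le _ _)); rewrite mX' addrAC subrr add0r.
  rewrite mxdotNl mxdotNr opprK mxdotZl mxdotZr /H mxdot_avg.
  by rewrite le_eqVlt; apply/orP; left; apply/eqP; ring.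
have step := pd_lyap_step_le (laplacian_sym hA) e (laplacian_psd hA (d := d))
  (laplacian_le_radius n_ge2 hA (d := d)) (rho_gt0 p2 rho2_le) p2 k1 b0 n0
  (hgap Jx) (hgap Jz) (hgap Jd) gle dle.
have drive := pd_drive_le (laplacian_sym hA) kappa1 beta z e (laplacian_psd hA (d := d))
  (laplacian_le_radius n_ge2 hA (d := d)) (rho_gt0 p2 rho2_le) gle.
rewrite -/p -KX' -z' in step; rewrite -/p in drive.
have /andP[s0 s1] := s01 phi01 r_gt0 psi01.
have /andP[t0 t1] := psir01 r_gt0 psi01.
rewrite /lyap.
apply: (lyap_contraction p2 rho2_le Lf_gt0 nu_gt0 phi01 r_gt0 psi01 kappa4_gt0
  hkappa1 hbeta heta (X := mxdot x x) (B := mxdot z (L *m z))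
  (E := mxdot e e) (P := mxdot p p) (H := H)
  (Y := mxdot (X - Aa - psi *: q) (X - Aa - psi *: q))) => //;
  rewrite ?mxdot_ge0 ?laplacian_psd ?opt_gap_ge0 //.
- exact: opt_gap_step.
(* Young with weight [s / 2] keeps part of the contraction of [y - psi q]; [|X' - X|^2] splits by
   [K] and [J] into [eta^2 (P + H)]. *)
- have -> : X' - Aa' = (X - Aa - psi *: q) + (X' - X).
    by rewrite hAa opprD addrA [RHS]addrC !addrA subrK.
  have sh : 0 < s / 2 by rewrite divr_gt0.
  apply: (le_trans (mxdot_add_le _ _ sh)); rewrite invf_div lerD2l.
  rewrite [mxdot (X' - X) _]mxdot_pythagoras mulmxBr KX' addrAC subrr add0r.
  rewrite mulmxBr JX' addrAC subrr add0r.
  rewrite !mxdotNl !mxdotNr !opprK !(mxdotZl eta) !(mxdotZr eta) -/H.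
  by rewrite le_eqVlt; apply/orP; left; apply/eqP; ring.
(* The message is used unscaled: [q - y] is [r] times the scaled error plus [(r - 1) y], the source
   of the two terms of [r0]. *)
- apply: (le_trans (mxdot_ctr_le _)).
  have -> : q - (X - Aa) = r *: (r^-1 *: q - (X - Aa)) + (r - 1) *: (X - Aa).
    rewrite scalerBr scalerA divff ?gt_eqF // scale1r scalerBl scale1r.
    by rewrite addrA subrK.
  apply: (le_trans (mxdot_add_le _ _ ltr01)); rewrite invr1.
  rewrite !(mxdotZl, mxdotZr).
  by rewrite le_eqVlt; apply/orP; left; apply/eqP; ring.
(* A convex combination, because [psi r <= 1]. *)
- have -> : X - Aa - psi *: q =
     (1 - psi * r) *: (X - Aa) + (psi * r) *: (X - Aa - r^-1 *: q).
    rewrite [X in _ = _ + X]scalerBr addrA -scalerDl subrK scale1r scalerA.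
    by rewrite mulfK ?gt_eqF.
  have t01 : 0 <= psi * r <= 1 by rewrite (ltW t0).
  apply: (le_trans (mxdot_convex _ _ t01)).
  by rewrite -[X in _ + _ * mxdot X X]opprB mxdotNl mxdotNr opprK.
- by apply: lyap_upper; rewrite ?opt_gap_ge0 ?mxdot_ge0.
Qed.

End OneStep.

(** * Averaging over the seeds *)

Section MeasurableMatrices.
Variables (R : realType) (dT : measure_display) (T : measurableType dT).

Definition measurable_mx m n (g : T -> 'M[R]_(m, n)) : Prop :=
  forall i j, measurable_fun [set: T] (fun w => g w i j).

Lemma measurable_mx_cst m n (B : 'M[R]_(m, n)) : measurable_mx (fun=> B).
Proof. by move=> i j; exact: measurable_cst. Qed.

Lemma measurable_mxD m n (g h : T -> 'M[R]_(m, n)) :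
  measurable_mx g -> measurable_mx h -> measurable_mx (fun w => g w + h w).
Proof.
move=> mg mh i j; under eq_fun do rewrite mxE.
by apply: measurable_funD; [exact: mg|exact: mh].
Qed.

Lemma measurable_mxZ m n a (g : T -> 'M[R]_(m, n)) :
  measurable_mx g -> measurable_mx (fun w => a *: g w).
Proof.
move=> mg i j; under eq_fun do rewrite mxE.
by apply: measurable_funM; [exact: measurable_cst|exact: mg].
Qed.

Lemma measurable_mxN m n (g : T -> 'M[R]_(m, n)) :
  measurable_mx g -> measurable_mx (fun w => - g w).
Proof.
move=> mg; under eq_fun do rewrite -scaleN1r.
exact: measurable_mxZ.
Qed.

Lemma measurable_mxM m n p (B : 'M[R]_(m, n)) (g : T -> 'M[R]_(n, p)) :
  measurable_mx g -> measurable_mx (fun w => B *m g w).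
Proof.
move=> mg i j; under eq_fun do rewrite mxE.
apply: measurable_sum => k.
by apply: measurable_funM; [exact: measurable_cst|exact: mg].
Qed.

Lemma measurable_mx_row m n (g : T -> 'M[R]_(m, n)) i :
  measurable_mx g -> measurable_mx (fun w => row i (g w)).
Proof. by move=> mg k j; under eq_fun do rewrite mxE; exact: mg. Qed.

Lemma measurable_mxdot m n (g h : T -> 'M[R]_(m, n)) :
  measurable_mx g -> measurable_mx h ->
  measurable_fun [set: T] (fun w => mxdot (g w) (h w)).
Proof.
move=> mg mh; under eq_fun do rewrite mxdotE.
apply: measurable_sum => i; apply: measurable_sum => j.
by apply: measurable_funM; [exact: mg|exact: mh].
Qed.

Lemma measurable_mx_rV n (g : T -> 'rV[R]_n) :
  measurable_mx g -> measurable_fun [set: T] (g : T -> borel_rV R n).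
Proof. by move=> mg; apply: measurable_rV => j; exact: mg. Qed.

Lemma measurable_rV_mx n (g : T -> 'rV[R]_n) :
  measurable_fun [set: T] (g : T -> borel_rV R n) -> measurable_mx g.
Proof.
move=> mg i j; rewrite (ord1 i).
exact: (measurableT_comp (@measurable_coord_rV R n j) mg).
Qed.

Lemma measurable_continuous_rV n (F : 'rV[R]_n -> R) (g : T -> 'rV[R]_n) :
  continuous F -> measurable_mx g -> measurable_fun [set: T] (fun w => F (g w)).
Proof.
move=> cF /measurable_mx_rV mg.
exact: (measurableT_comp (continuous_measurable_rV cF) mg).
Qed.

End MeasurableMatrices.

(** Needed for measurability of the iterates. The Lipschitz bound places the squared coordinate
    difference below a continuous function vanishing at [x]. *)
Lemma continuous_grad_coord (R : realType) d (f : 'rV[R]_d -> R) (ell : R) j :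
  (forall x y, mxdot (grad f x - grad f y) (grad f x - grad f y)
     <= ell ^+ 2 * mxdot (x - y) (x - y)) ->
  continuous (fun x => grad f x 0 j).
Proof.
move=> lip x; apply/(@cvgrPdist_lt _ R^o _ (nbhs x) (nbhs_filter x)) => e e0.
pose h (y : 'rV[R]_d) := ell ^+ 2 * mxdot (x - y) (x - y).
have ch : continuous h.
  have -> : h = fun y : 'rV[R]_d =>
      \sum_(k < d) ell ^+ 2 * ((x 0 k - y 0 k) * (x 0 k - y 0 k)).
    apply/funext => y; rewrite /h mxdotE big_ord1 mulr_sumr.
    by apply: eq_bigr => k _; rewrite !mxE.
  apply: continuous_big; first exact: add_continuous.
  move=> k _ y.
  apply: (@continuousM R _ (fun=> ell ^+ 2) (fun y : 'rV[R]_d =>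
    (x 0 k - y 0 k) * (x 0 k - y 0 k))); first exact: cst_continuous.
  have c : continuous (fun y : 'rV[R]_d => x 0 k - y 0 k).
    move=> w; apply: continuousB; first exact: cst_continuous.
    exact: coord_continuous.
  by apply: continuousM; exact: c.
have hx : h x = 0 by rewrite /h subrr mxdot0l mulr0.
have e2 : 0 < e ^+ 2 by rewrite exprn_gt0.
have /(@cvgrPdist_lt _ R^o _ (nbhs x) (nbhs_filter x)) /(_ _ e2) := ch x.
rewrite hx; apply: filterS => y; rewrite sub0r normrN => hy.
rewrite -(ltr_pXn2r (n := 2)) ?nnegrE ?normr_ge0 ?(ltW e0) //.
apply: le_lt_trans hy; apply: le_trans (ler_norm _).
apply: le_trans (lip x y).
rewrite real_normK ?num_real // mxdotE big_ord1 (bigD1 j) //= !mxE -expr2.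
by rewrite lerDl; apply: sumr_ge0 => k _; rewrite -expr2 sqr_ge0.
Qed.

(** * Stacked iterates and their measurability *)

Definition stack (R : realType) n d (u : 'I_n -> 'rV[R]_d) : 'M[R]_(n, d) :=
  \matrix_(i < n) u i.

Section Algorithm.
Variables (R : realType) (n d : nat) (A : 'M[R]_n).
Hypotheses (n_ge2 : (2 <= n)%N) (hA : is_adjacency A).
Variables (f : 'I_n -> 'rV[R]_d -> R) (alpha beta eta psi : R)
  (x0 : 'I_n -> 'rV[R]_d).
Local Notation L := (laplacian A).
Local Notation J := (avg_mx R n).

Section Deterministic.
Variable Ck : nat -> 'I_n -> 'rV[R]_d -> 'rV[R]_d.
Let S k := algorithm L f alpha beta eta psi x0 Ck k.
Local Notation Xm k := (stack (st_x (S k))).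
Local Notation Am k := (stack (st_a (S k))).
Local Notation Vm k := (stack (st_v (S k))).
Local Notation Qm k := (stack (st_q (S k))).

Lemma row_laplacian_stack (u : 'I_n -> 'rV[R]_d) i :
  \sum_(j < n) L i j *: u j = row i (L *m stack u).
Proof.
rewrite row_mul mulmx_sum_row; apply: eq_bigr => j _.
by rewrite rowK !mxE.
Qed.

Lemma algorithm_diff k i : st_a (S k) i - st_b (S k) i = row i (L *m Am k).
Proof.
elim: k => [|k IH] /=.
  have -> : Am 0 = 0 by apply/row_matrixP => j; rewrite rowK row0.
  by rewrite mulmx0 row0 subrr.
have -> : stack (fun i => st_a (S k) i + psi *: st_q (S k) i) = Am k + psi *: Qm k.
  by apply/row_matrixP => j; rewrite linearD linearZ /= !rowK.
rewrite -/(S k) row_laplacian_stack mulmxDr -scalemxAr.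
rewrite [RHS]linearD /= [X in _ = _ + X]linearZ /= -IH.
rewrite scalerBr !opprD opprK addrACA; congr (_ + _).
by rewrite addrA subrr add0r.
Qed.

Lemma algorithm_step k :
  [/\ Am k.+1 = Am k + psi *: Qm k,
      Xm k.+1 = Xm k - (eta * alpha) *: (L *m (Am k + Qm k))
        - eta *: (beta *: Vm k + grads f (Xm k))
    & Vm k.+1 = Vm k + (eta * beta) *: (L *m (Am k + Qm k))].
Proof.
have e i : st_a (S k) i - st_b (S k) i + \sum_(j < n) L i j *: st_q (S k) j =
    row i (L *m (Am k + Qm k)).
  by rewrite algorithm_diff row_laplacian_stack mulmxDr linearD.
have rD i (X Y : 'M[R]_(n, d)) : row i (X + Y) = row i X + row i Y.
  exact: linearD.
have rN i (X : 'M[R]_(n, d)) : row i (- X) = - row i X by exact: linearN.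
have rZ i c (X : 'M[R]_(n, d)) : row i (c *: X) = c *: row i X by exact: linearZ.
split; apply/row_matrixP => i; rewrite !(rD, rN, rZ) !rowK //=.
- by rewrite -/(S k) e.
- by rewrite -/(S k) e.
Qed.

Lemma algorithm_dual_mean k : J *m Vm k = 0.
Proof.
elim: k => [|k IH].
  have -> : Vm 0 = 0 by apply/row_matrixP => j; rewrite rowK row0.
  by rewrite mulmx0.
have [_ _ ->] := algorithm_step k.
by rewrite mulmxDr -scalemxAr mulmxA avg_laplacian // mul0mx scaler0 addr0.
Qed.

(** The first message is covered too, because [a] starts at zero. *)
Lemma algorithm_msg k i : st_q (S k) i = Ck k i (row i (Xm k - Am k)).
Proof.
rewrite linearB /= !rowK; case: k => [|k] //=.
by rewrite subr0.
Qed.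

End Deterministic.

Variable Lf : R.
Hypotheses (hdiff : forall i x, differentiable (f i) x)
  (hLip : forall i x y,
     enorm (grad (f i) x - grad (f i) y) <= Lf * enorm (x - y)).

Lemma measurable_mx_grad (dT : measure_display) (T : measurableType dT) i
    (g : T -> 'rV[R]_d) :
  measurable_mx g -> measurable_mx (fun w => grad (f i) (g w)).
Proof.
move=> mg k j; rewrite (ord1 k).
apply: (measurable_continuous_rV (F := fun x => grad (f i) x 0 j)) => //.
by apply: continuous_grad_coord; exact: grad_lipschitz_sqr (hLip i).
Qed.

Lemma measurable_mx_stack (dT : measure_display) (T : measurableType dT)
    (g : T -> 'I_n -> 'rV[R]_d) :
  (forall i, measurable_mx (fun w => g w i)) ->
  measurable_mx (fun w => stack (g w)).
Proof. by move=> mg i j; under eq_fun do rewrite mxE; exact: mg. Qed.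

Lemma measurable_mx_mean_row (dT : measure_display) (T : measurableType dT)
    (g : T -> 'M[R]_(n, d)) :
  measurable_mx g -> measurable_mx (fun w => mean_row (g w)).
Proof.
move=> mg; under eq_fun do rewrite -(row_avg _ (Ordinal n_ge2)).
by apply: measurable_mx_row; exact: measurable_mxM.
Qed.

Variables (dZ : measure_display) (Z : measurableType dZ)
  (C : Z -> 'rV[R]_d -> 'rV[R]_d).
Hypothesis mC : measurable_fun [set: Z * borel_rV R d]
    (fun p : Z * borel_rV R d => (C p.1 p.2 : borel_rV R d)).

Let run (W : Type) (seed : nat * 'I_n -> W -> Z) k w :=
  algorithm L f alpha beta eta psi x0 (fun m j => C (seed (m, j) w)) k.

(** Only seeds of rounds before [k] are assumed measurable, over an arbitrary domain: this serves
    both [Omega] and [Omega] with the sigma-algebra of past seeds. The message of round [k] is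
    excluded, as it uses a seed of that round. *)
Lemma algorithm_measurable (dT : measure_display) (T : measurableType dT)
    (seed : nat * 'I_n -> T -> Z) k :
  (forall m i, (m < k)%N -> measurable_fun [set: T] (seed (m, i))) ->
  [/\ measurable_mx (fun w => stack (st_x (run seed k w))),
      measurable_mx (fun w => stack (st_a (run seed k w)))
    & measurable_mx (fun w => stack (st_v (run seed k w)))].
Proof.
elim: k => [|k IH] ms; first by split;
    [exact: (measurable_mx_cst (stack x0))
    |exact: (measurable_mx_cst (stack (fun=> 0 : 'rV[R]_d)))..].
have [mX mA mV] := IH (fun m i mk => ms m i (ltnW mk)).
have mQ : measurable_mx (fun w => stack (st_q (run seed k w))).
  apply: measurable_mx_stack => i.
  under eq_fun do rewrite /run algorithm_msg.
  apply: measurable_rV_mx.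
  apply: (measurableT_comp mC (measurable_fun_pair (ms k i (ltnSn k)) _)).
  apply: measurable_mx_rV; apply: measurable_mx_row.
  by apply: measurable_mxD mX _; exact: measurable_mxN.
have mU : measurable_mx (fun w => L *m (stack (st_a (run seed k w))
     + stack (st_q (run seed k w)))).
  by apply: measurable_mxM; exact: measurable_mxD.
have st w := algorithm_step (fun m j => C (seed (m, j) w)) k.
have eA w : stack (st_a (run seed k.+1 w)) = _ := let: And3 e _ _ := st w in e.
have eX w : stack (st_x (run seed k.+1 w)) = _ := let: And3 _ e _ := st w in e.
have eV w : stack (st_v (run seed k.+1 w)) = _ := let: And3 _ _ e := st w in e.
split.
- under eq_fun do rewrite eX.
  apply: measurable_mxD; first apply: measurable_mxD mX _.
    by apply: measurable_mxN; exact: measurable_mxZ.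
  apply: measurable_mxN; apply: measurable_mxZ; apply: measurable_mxD.
    exact: measurable_mxZ.
  apply: (measurable_mx_stack (g := fun w i =>
    grad (f i) (row i (stack (st_x (run seed k w)))))) => i.
  by apply: measurable_mx_grad; exact: measurable_mx_row.
- under eq_fun do rewrite eA.
  by apply: measurable_mxD mA _; exact: measurable_mxZ.
- under eq_fun do rewrite eV.
  by apply: measurable_mxD mV _; exact: measurable_mxZ.
Qed.

End Algorithm.

(** Agent by agent, the seed [(k, i)] is independent of the past, which determines [y_k];
    integrating it out first leaves the compressor inequality at a fixed vector. Extended reals
    avoid presupposing finite second moments. *)
Lemma compressor_error_le (R : realType) (n d : nat) (A : 'M[R]_n)
    (f : 'I_n -> 'rV[R]_d -> R) (Lf alpha beta eta psi phi r : R)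
    (x0 : 'I_n -> 'rV[R]_d)
    (hLip : forall i x y,
       enorm (grad (f i) x - grad (f i) y) <= Lf * enorm (x - y))
    (dZ : measure_display) (Z : measurableType dZ) (mu : probability Z R)
    (C : Z -> 'rV[R]_d -> 'rV[R]_d) (hphi : 0 < phi <= 1)
    (hC : is_compressor mu C phi r)
    (dO : measure_display) (Omega : measurableType dO) (P : probability Omega R)
    (seed : nat * 'I_n -> Omega -> Z) (hseed : iid_with_law P mu seed) (k : nat)
    (S := fun w => algorithm (laplacian A) f alpha beta eta psi x0
                     (fun m j => C (seed (m, j) w)) k)
    (Y := fun w => stack (st_x (S w)) - stack (st_a (S w)))
    (q := fun w => stack (st_q (S w))) :
  (\int[P]_w (mxdot (r^-1 *: q w - Y w) (r^-1 *: q w - Y w))%:E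
   <= (1 - phi)%:E * \int[P]_w (mxdot (Y w) (Y w))%:E)%E.
Proof.
have [mC cC] := hC.
pose past : pred (nat * 'I_n) := fun p => (p.1 < k)%N.
have mY (dT : measure_display) (T : measurableType dT)
    (sd : nat * 'I_n -> T -> Z) :
  (forall m i, (m < k)%N -> measurable_fun [set: T] (sd (m, i))) ->
  measurable_mx (fun w : T => stack (st_x (algorithm (laplacian A) f alpha beta
     eta psi x0 (fun m j => C (sd (m, j) w)) k)) - stack (st_a (algorithm
     (laplacian A) f alpha beta eta psi x0 (fun m j => C (sd (m, j) w)) k))).
  move=> ms.
  have [mX mA _] := algorithm_measurable A alpha beta eta psi x0 hLip mC ms.
  by apply: measurable_mxD mX _; exact: measurable_mxN.
have mseed i : measurable_fun [set: Omega] (seed i) by case: hseed.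
have mYO : measurable_mx Y by apply: mY.
(* [mY] is used here over the sigma-algebra of past seeds, each of which is measurable through
   one-element cylinders. *)
have mYi i : measurable_fun [set: g_sigma_algebraType (cylinders seed past)]
    ((fun w => row i (Y w)) : g_sigma_algebraType (cylinders seed past) -> borel_rV R d).
  apply: measurable_mx_rV; apply: measurable_mx_row.
  apply: (mY _ (g_sigma_algebraType (cylinders seed past))) => m j mk _ B mB.
  rewrite setTI; apply: sub_sigma_algebra.
  exists [:: (m, j)], (fun=> B); split=> //.
    by move=> p; rewrite inE => /eqP ->.
  apply/seteqP; split => [w /= h p /=|w /= h]; last by apply: h => /=; rewrite inE.
  by rewrite inE => /eqP ->.
pose hr (p : Z * borel_rV R d) : R := enorm (r^-1 *: C p.1 p.2 - p.2) ^+ 2.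
pose h (p : Z * borel_rV R d) : \bar R := (hr p)%:E.
have h0 p : (0 <= h p)%E by rewrite lee_fin sqr_ge0.
have mh : measurable_fun [set: Z * borel_rV R d] h.
  apply/(measurable_EFinP _ hr).
  have -> : hr = fun p => mxdot (r^-1 *: C p.1 p.2 - (p.2 : 'rV[R]_d))
                                (r^-1 *: C p.1 p.2 - (p.2 : 'rV[R]_d)).
    by apply/funext => p; exact: enorm_sqr.
  have m1 : measurable_mx (fun p : Z * borel_rV R d =>
      r^-1 *: C p.1 p.2 - (p.2 : 'rV[R]_d)).
    apply: measurable_mxD; first by apply: measurable_mxZ; exact: measurable_rV_mx.
    by apply: measurable_mxN; apply: measurable_rV_mx; exact: measurable_snd.
  exact: measurable_mxdot.
have phi0 : 0 <= 1 - phi by case/andP: hphi; rewrite subr_ge0.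
have mD i : measurable_fun [set: Omega]
    (fun w => (mxdot (row i (Y w)) (row i (Y w)))%:E).
  apply/measurable_EFinP; apply: measurable_mxdot; exact: measurable_mx_row.
have mYi' i := measurable_fun_cylinders hseed (mYi i).
have eh w : (mxdot (r^-1 *: q w - Y w) (r^-1 *: q w - Y w))%:E =
    (\sum_(i < n) h (seed (k, i) w, row i (Y w)))%E.
  rewrite mxdot_rows sumEFin; congr _%:E; apply: eq_bigr => i _.
  rewrite /hr enorm_sqr /= linearB linearZ /= /q rowK /S algorithm_msg.
  by [].
under eq_integral do rewrite eh.
rewrite ge0_integral_sum //; last first.
  move=> i; apply: (measurableT_comp mh).
  exact: measurable_fun_pair (mseed _) (mYi' i).
apply: (@le_trans _ _ (\sum_(i < n) ((1 - phi)%:E *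
    \int[P]_w (mxdot (row i (Y w)) (row i (Y w)))%:E))%E).
  apply: lee_sum => i _.
  have ki : (k, i) \notin past by rewrite unfold_in /past /= ltnn.
  rewrite (seed_integral hseed ki (mYi i) mh h0).
  rewrite -ge0_integralZl_EFin //; last by move=> w _; rewrite lee_fin mxdot_ge0.
  apply: ge0_le_integral => //.
  - by move=> w _; apply: integral_ge0.
  - exact: (measurableT_comp (measurable_fun_fubini_tonelli_G (m1 := mu) h mh h0)
      (mYi' i)).
  - exact: measurable_funeM.
  - by move=> w _; rewrite /h /= -EFinM -enorm_sqr; exact: cC.
rewrite -ge0_sume_distrr; last first.
  by move=> i _; apply: integral_ge0 => w _; rewrite lee_fin mxdot_ge0.
rewrite -ge0_integral_sum //; last by move=> i w _; rewrite lee_fin mxdot_ge0.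
rewrite le_eqVlt; apply/orP; left; apply/eqP; congr (_ * _)%E.
by apply: eq_integral => w _; rewrite mxdot_rows sumEFin.
Qed.

Theorem theorem2 (R : realType) (n d : nat) (hn : (2 <= n)%N) (hd : (0 < d)%N)
    (A : 'M[R]_n) (hA : is_adjacency A) (hconn : graph_connected A)
    (f : 'I_n -> 'rV[R]_d -> R) (Lf : R) (hLf : 0 < Lf)
    (hdiff : forall i x, differentiable (f i) x)
    (hLip : forall i x y,
       enorm (grad (f i) x - grad (f i) y) <= Lf * enorm (x - y))
    (fstar nu : R)
    (hmin : is_minimum (average_cost f) fstar)
    (hnu : 0 < nu)
    (hPL : polyak_lojasiewicz (average_cost f) fstar nu)
    (dZ : measure_display) (Z : measurableType dZ) (mu : probability Z R)
    (C : Z -> 'rV[R]_d -> 'rV[R]_d) (phi r : R)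
    (hphi : 0 < phi <= 1) (hr : 0 < r)
    (hC : is_compressor mu C phi r)
    (dO : measure_display) (Omega : measurableType dO) (P : probability Omega R)
    (seed : nat * 'I_n -> Omega -> Z) (hseed : iid_with_law P mu seed)
    (kappa1 kappa4 alpha beta eta psi : R)
    (hkappa4 : 0 < kappa4)
    (hkappa1 : Num.max
       ((9 + kappa4) / (2 * min_pos_eigenvalue (laplacian A))) 1 <= kappa1)
    (halpha : alpha = kappa1 * beta)
    (hbeta : kappa2 (min_pos_eigenvalue (laplacian A)) Lf kappa1 kappa4 < beta)
    (heta : 0 < eta <
       kappa3 (spectral_radius (laplacian A))
              (min_pos_eigenvalue (laplacian A)) Lf phi r alpha beta psi)
    (hpsi : 0 < psi <= r^-1)
    (x0 : 'I_n -> 'rV[R]_d) :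
  let L := laplacian A in
  let F := average_cost f in
  let x := fun k i w =>
    st_x (algorithm L f alpha beta eta psi x0
            (fun m j => C (seed (m, j) w)) k) i in
  let xbar := fun k w => average (fun i => x k i w) in
  let eps := epsilon (spectral_radius L) (min_pos_eigenvalue L)
               Lf nu phi r alpha beta eta psi in
  0 < eps < 1 /\
  exists c : R, forall k : nat,
    (\sum_(i < n)
       'E_P[(fun w => enorm (x k i w - xbar k w) ^+ 2 + (F (xbar k w) - fstar))%R]
     <= (c * (1 - eps) ^+ k)%:E)%E.
Proof.
move=> L F x xbar eps; subst alpha.
have p2 := rho2_gt0 hn hA hconn.
have pr := min_pos_eigenvalue_le_radius hn hA hconn.
have e01 : 0 < eps < 1 := epsilon01 p2 pr hnu hphi hr hpsi hkappa1 hbeta heta.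
split=> //.
have /andP[e0 e1] := e01; have e1' : 0 <= 1 - eps by rewrite subr_ge0 ltW.
have [Q [LQ JQ]] := laplacian_pinv hn hA hconn.
pose S k w := algorithm L f (kappa1 * beta) beta eta psi x0
  (fun m j => C (seed (m, j) w)) k.
pose X k w := stack (st_x (S k w)); pose Aa k w := stack (st_a (S k w)).
pose V k w := stack (st_v (S k w)); pose q k w := stack (st_q (S k w)).
pose W k w := lyap A f fstar beta kappa1 Q (X k w) (Aa k w) (V k w).
pose D k w := mxdot (X k w - Aa k w) (X k w - Aa k w).
pose G k w := mxdot (r^-1 *: q k w - (X k w - Aa k w))
                    (r^-1 *: q k w - (X k w - Aa k w)).
pose g := gap_coef (spectral_radius L) phi r beta eta psi kappa1.
have g0 : 0 <= g := gap_coef_ge0 p2 pr hphi hr hpsi hkappa1 hbeta heta.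
have phi0 : 0 <= 1 - phi by case/andP: hphi; rewrite subr_ge0.
have step k w : W k.+1 w + g * ((1 - phi) * D k w) <= (1 - eps) * W k w + g * G k w.
  have [eA eX eV] := algorithm_step A f (kappa1 * beta) beta eta psi x0
    (fun m j => C (seed (m, j) w)) k.
  apply: (lyap_step hn hA hconn hLf hdiff hLip hmin hnu hPL hphi hr hpsi hkappa4
    hkappa1 hbeta heta LQ JQ _ erefl eX eA eV).
  exact: algorithm_dual_mean.
have low k w := lyap_lower hn hA hconn hmin beta hkappa4 hkappa1 JQ (X k w) (Aa k w) (V k w).
have D0 k w : 0 <= D k w := mxdot_ge0 _.
have G0 k w : 0 <= G k w := mxdot_ge0 _.
have N0 k w := mxdot_ge0 ((1%:M - avg_mx R n) *m X k w).
have O0 k w := opt_gap_ge0 hmin (X k w).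
have W0 k w : 0 <= W k w by have := low k w; have := D0 k w; have := N0 k w;
  have := O0 k w; rewrite /W /D; lra.
have DW k w : D k w <= 3 * W k w by have := low k w; have := N0 k w;
  have := O0 k w; rewrite /W /D; lra.
have [mC _] := hC.
have mseed i : measurable_fun [set: Omega] (seed i) by case: hseed.
have mst k := algorithm_measurable A (kappa1 * beta) beta eta psi x0 hLip mC
  (fun m i (_ : (m < k)%N) => mseed (m, i)).
have mX k : measurable_mx (X k) by case: (mst k).
have mA k : measurable_mx (Aa k) by case: (mst k).
have mV k : measurable_mx (V k) by case: (mst k).
have mQ k : measurable_mx (q k).
  apply: measurable_mx_stack => i.
  under eq_fun do rewrite algorithm_msg.
  apply: measurable_rV_mx.
  apply: (measurableT_comp mC (measurable_fun_pair (mseed (k, i)) _)).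
  apply: measurable_mx_rV; apply: measurable_mx_row.
  by apply: measurable_mxD (mX k) _; apply: measurable_mxN; exact: mA.
have mY k : measurable_mx (fun w => X k w - Aa k w).
  by apply: measurable_mxD (mX k) _; apply: measurable_mxN; exact: mA.
have mD k : measurable_fun [set: Omega] (D k) by apply: measurable_mxdot; exact: mY.
have mG k : measurable_fun [set: Omega] (G k).
  have m1 : measurable_mx (fun w => r^-1 *: q k w - (X k w - Aa k w)).
    apply: measurable_mxD; first by apply: measurable_mxZ; exact: mQ.
    by apply: measurable_mxN; exact: mY.
  exact: measurable_mxdot.
have cF : continuous F.
  by move=> y; apply: differentiable_continuous; apply: differentiable_average_cost.
have mbar k := measurable_mx_mean_row hn (mX k).
have mF k : measurable_fun [set: Omega] (fun w => F (mean_row (X k w)) - fstar).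
  apply: measurable_funB; last exact: measurable_cst.
  exact: measurable_continuous_rV.
have mW k : measurable_fun [set: Omega] (W k).
  have mz : measurable_mx (fun w => dual_var f beta Q (X k w) (V k w)).
    apply: measurable_mxM; apply: measurable_mxD (mV k) _; apply: measurable_mxZ.
    apply: (measurable_mx_stack (g := fun w i => grad (f i) (mean_row (X k w)))) => i.
    exact: measurable_mx_grad hLip _ _ _ _ _.
  have mKX : measurable_mx (fun w => (1%:M - avg_mx R n) *m X k w).
    exact: measurable_mxM.
  apply: measurable_funD; last exact: mD.
  apply: measurable_funD; last first.
    by apply: measurable_funM; [exact: measurable_cst|exact: mF].
  apply: measurable_funD; last exact: measurable_mxdot.
  apply: measurable_funD; apply: measurable_funM; try exact: measurable_cst.
    exact: measurable_mxdot.
  by apply: measurable_mxdot => //; exact: measurable_mxM.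
(* The initial state without messages is deterministic, so [W 0] is constant and [point] picks an
   arbitrary outcome. *)
have IW k : (\int[P]_w (W k w)%:E <= ((1 - eps) ^+ k * W 0%N point)%:E)%E.
  elim: k => [|k IH].
    rewrite expr0 mul1r.
    under eq_integral => w _ do rewrite (_ : W 0%N w = W 0%N point) //.
    by have := expectation_cst P (W 0%N point); rewrite unlock => ->.
  (* Finiteness comes from the induction hypothesis; through [D <= 3 W] it passes to the integral of
     [D], which is cancelled below. *)
  have fW : (\int[P]_w (W k w)%:E \is a fin_num)%E.
    rewrite ge0_fin_numE; first exact: le_lt_trans IH (ltry _).
    by apply: integral_ge0 => w _; rewrite lee_fin.
  have mEW j : measurable_fun [set: Omega] (EFin \o W j) by apply/measurable_EFinP.
  have mED j : measurable_fun [set: Omega] (EFin \o D j) by apply/measurable_EFinP.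
  have mEG j : measurable_fun [set: Omega] (EFin \o G j) by apply/measurable_EFinP.
  have ID : (\int[P]_w (D k w)%:E <= 3%:E * \int[P]_w (W k w)%:E)%E.
    rewrite -ge0_integralZl_EFin //; try solve [exact: mEW|exact: mED|exact: mEG|by move=> w _; rewrite lee_fin].
    apply: ge0_le_integral => //; try solve [exact: mEW|exact: mED|exact: mEG|by move=> w _; rewrite lee_fin].
    by apply: measurable_funeM; exact: mEW.
  have fD : (\int[P]_w (D k w)%:E \is a fin_num)%E.
    rewrite ge0_fin_numE; last by apply: integral_ge0 => w _; rewrite lee_fin.
    by apply: le_lt_trans ID _; rewrite -(fineK fW) -EFinM ltry.
  have IG : (\int[P]_w (G k w)%:E <= (1 - phi)%:E * \int[P]_w (D k w)%:E)%E.
    exact: (compressor_error_le A _ _ _ _ x0 hLip hphi hC hseed k).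
  have main : (\int[P]_w (W k.+1 w)%:E + (g * (1 - phi))%:E * \int[P]_w (D k w)%:E
     <= (1 - eps)%:E * \int[P]_w (W k w)%:E + g%:E * \int[P]_w (G k w)%:E)%E.
    have mM c (u : Omega -> R) : measurable_fun [set: Omega] (EFin \o u) ->
      measurable_fun [set: Omega] (fun w => c%:E * (u w)%:E)%E.
      by move=> mu'; exact: measurable_funeM.
    have M0 c (u : Omega -> R) w : 0 <= c -> (forall w, 0 <= u w) ->
      (0 <= c%:E * (u w)%:E)%E by move=> c0 u0; rewrite -EFinM lee_fin mulr_ge0.
    have IM c (u : Omega -> R) : 0 <= c -> (forall w, 0 <= u w) ->
        measurable_fun [set: Omega] (EFin \o u) ->
        (c%:E * \int[P]_w (u w)%:E = \int[P]_w (c%:E * (u w)%:E))%E.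
      move=> c0 u0 mu'; rewrite ge0_integralZl_EFin //.
      by move=> w _; rewrite lee_fin.
    have IA (u v : Omega -> \bar R) :
        (forall w, 0 <= u w)%E -> measurable_fun [set: Omega] u ->
        (forall w, 0 <= v w)%E -> measurable_fun [set: Omega] v ->
        (\int[P]_w u w + \int[P]_w v w = \int[P]_w (u w + v w))%E.
      by move=> u0 mu' v0 mv; rewrite ge0_integralD.
    have gp : 0 <= g * (1 - phi) by rewrite mulr_ge0.
    have W0E j w : (0 <= (W j w)%:E)%E by rewrite lee_fin.
    rewrite (IM _ _ gp (D0 k) (mED k)) (IM _ _ e1' (W0 k) (mEW k)).
    rewrite (IM _ _ g0 (G0 k) (mEG k)).
    rewrite (IA _ _ (W0E k.+1) (mEW k.+1) (fun w => M0 _ _ w gp (D0 k))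
      (mM _ _ (mED k))).
    rewrite (IA _ _ (fun w => M0 _ _ w e1' (W0 k)) (mM _ _ (mEW k))
      (fun w => M0 _ _ w g0 (G0 k)) (mM _ _ (mEG k))).
    apply: ge0_le_integral.
    - exact: measurableT.
    - by move=> w _; apply: adde_ge0; [exact: W0E|exact: M0].
    - by apply: emeasurable_funD; [exact: mEW|apply: mM; exact: mED].
    - by apply: emeasurable_funD; apply: mM; [exact: mEW|exact: mEG].
    - by move=> w _; rewrite -!EFinM -!EFinD lee_fin -mulrA.
  have : (\int[P]_w (W k.+1 w)%:E + (g * (1 - phi))%:E * \int[P]_w (D k w)%:E
     <= (1 - eps)%:E * \int[P]_w (W k w)%:E
       + (g * (1 - phi))%:E * \int[P]_w (D k w)%:E)%E.
    apply: (le_trans main); rewrite leeD2l // EFinM -muleA.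
    by rewrite lee_wpmul2l // lee_fin.
  rewrite leeD2rE; last by rewrite fin_numM.
  move=> /le_trans; apply.
  by rewrite exprS -mulrA EFinM lee_wpmul2l // lee_fin.
(* The 3 is the loss in [lyap_lower]. *)
exists (3 * W 0%N point) => k.
pose u i w := enorm (x k i w - xbar k w) ^+ 2 + (F (xbar k w) - fstar).
have bar w : xbar k w = mean_row (X k w).
  by rewrite /xbar /mean_row; congr average; apply/funext => i; rewrite rowK.
have F0 w : 0 <= F (xbar k w) - fstar by case: hmin => _ h; rewrite subr_ge0.
have u0 i w : 0 <= u i w by rewrite addr_ge0 ?sqr_ge0.
have mui i : measurable_fun [set: Omega] (EFin \o u i).
  apply/measurable_EFinP; rewrite /u.
  under eq_fun do rewrite bar enorm_sqr.
  apply: measurable_funD; last exact: mF.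
  have m1 : measurable_mx (fun w => x k i w - mean_row (X k w)).
    apply: measurable_mxD; last exact: measurable_mxN.
    have := measurable_mx_row i (mX k).
    by under eq_fun do rewrite rowK.
  exact: measurable_mxdot.
have -> : (\sum_(i < n) 'E_P[u i] = \int[P]_w (\sum_(i < n) u i w)%:E)%E.
  under eq_bigr do rewrite unlock.
  rewrite -ge0_integral_sum //; last by move=> i w _; rewrite lee_fin.
  by apply: eq_integral => w _; rewrite sumEFin.
have uE w : \sum_(i < n) u i w <= 3 * W k w.
  rewrite big_split /= sumr_const card_ord.
  have -> : \sum_(i < n) enorm (x k i w - xbar k w) ^+ 2 =
      mxdot ((1%:M - avg_mx R n) *m X k w) ((1%:M - avg_mx R n) *m X k w).
    rewrite mxdot_rows; apply: eq_bigr => i _; rewrite enorm_sqr bar.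
    by rewrite mulmxBl mul1mx linearB /= row_avg rowK.
  rewrite -[X in _ + X]mulr_natl bar; have := low k w; have := D0 k w.
  rewrite /W /D /opt_gap -/F; lra.
apply: (@le_trans _ _ (3%:E * \int[P]_w (W k w)%:E)%E); last first.
  have -> : 3 * W 0%N point * (1 - eps) ^+ k =
      3 * ((1 - eps) ^+ k * W 0%N point) by ring.
  by rewrite EFinM lee_wpmul2l ?lee_fin //; exact: IW.
rewrite -ge0_integralZl_EFin //; last first.
- by apply/measurable_EFinP; exact: mW.
- by move=> w _; rewrite lee_fin.
apply: ge0_le_integral.
- exact: measurableT.
- by move=> w _; rewrite lee_fin sumr_ge0.
- by apply/measurable_EFinP; apply: measurable_sum => i; exact/measurable_EFinP/mui.
- by apply: measurable_funeM; apply/measurable_EFinP.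
- by move=> w _; rewrite -EFinM lee_fin.
Qed.
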